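(* There exists an absolute constant $c>0$ (not depending on $n,\sigma,q$) such that the following holds. Let $n\ge 3$, $\sigma>0$, let $q$ be an integer with $1\le q\le n$, and for $\boldsymbol\mu\in\mathbb{R}^n$ let $\mathbf{y}=\boldsymbol\mu+\boldsymbol\xi$ where $\boldsymbol\xi$ has distribution $\mathcal{N}(0,\sigma^2 I_{n\times n})$. Let $\hat{\boldsymbol\mu}^{Q-conv}$ be the estimator defined in the context. Then $$\sup_{\boldsymbol\mu\in\mathbb{R}^n}\left(\mathbb{E}_{\boldsymbol\mu}\|\hat{\boldsymbol\mu}^{Q-conv}-\boldsymbol\mu\|-\min_{\boldsymbol u\in\mathcal{S}^{\mathrm C}_q}\|\boldsymbol u-\boldsymbol\mu\|\right)\le c\sqrt{\frac{\sigma^2q}{n}\log\left(\frac{en}{q}\right)},$$ $$\sup_{\boldsymbol\mu\in\mathbb{R}^n}\left(\mathbb{E}_{\boldsymbol\mu}\|\hat{\boldsymbol\mu}^{Q-conv}-\boldsymbol\mu\|^2-\min_{\boldsymbol u\in\mathcal{S}^{\mathrm C}_q}\|\boldsymbol u-\boldsymbol\mu\|^2\right)\le \frac{c\,\sigma^2q}{n}\log\left(\frac{en}{q}\right).$$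
   Context: Norm: $\|\boldsymbol u\|^2=\frac1n\sum_{i=1}^n u_i^2$ for $\boldsymbol u\in\mathbb{R}^n$ (scaled Euclidean norm). $\mathbb{E}_{\boldsymbol\mu}$ is the expectation with respect to the distribution of $\mathbf{y}=\boldsymbol\mu+\boldsymbol\xi$. $\mathcal{S}^{\mathrm C}=\{\boldsymbol u\in\mathbb{R}^n: 2u_i\le u_{i+1}+u_{i-1},\ i=2,\dots,n-1\}$. For $\boldsymbol u\in\mathbb{R}^n$, $q(\boldsymbol u)\ge1$ is the integer such that $q(\boldsymbol u)-1$ is the cardinality of $\{i\in\{2,\dots,n-1\}: 2u_i\ne u_{i+1}+u_{i-1}\}$, and $\mathcal{S}^{\mathrm C}_q=\{\boldsymbol u\in\mathcal{S}^{\mathrm C}: q(\boldsymbol u)\le q\}$. Estimator $\hat{\boldsymbol\mu}^{Q-conv}$ (a function of $\mathbf{y}$, with $\sigma$ known): for every $J\subseteq\{2,\dots,n-1\}$ (including $J=\emptyset$) let $$\nu_J=\frac{\exp(-|J|)}{H_C\binom{n-2}{|J|}},\qquad H_C=\sum_{i=0}^{n-2}\exp(-i),$$ let $W_J=\{\boldsymbol u\in\mathbb{R}^n:\ 2u_i=u_{i+1}+u_{i-1}\ \text{for all } i\in\{2,\dots,n-1\}\setminus J\}$, and let $Q_J\in\mathbb{R}^{n\times n}$ be the orthogonal projector onto $W_J$. For $\boldsymbol\theta=(\theta_J)_{J\subseteq\{2,\dots,n-1\}}$ with real entries put $\boldsymbol\mu_{\boldsymbol\theta}=\sum_{J}\theta_J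 Q_J\mathbf{y}$. Let $\Lambda'=\{\boldsymbol\theta:\ \theta_J\ge0\ \text{for all }J,\ \sum_J\theta_J=1\}$. Then $\hat{\boldsymbol\mu}^{Q-conv}=\boldsymbol\mu_{\hat{\boldsymbol\theta}}$, where $\hat{\boldsymbol\theta}$ is a minimizer over $\boldsymbol\theta\in\Lambda'$ of $$\|\boldsymbol\mu_{\boldsymbol\theta}-\mathbf{y}\|^2+\sum_{J\subseteq\{2,\dots,n-1\}}\theta_J\left(\frac{2\sigma^2|J|}{n}+\frac12\|\boldsymbol\mu_{\boldsymbol\theta}-Q_J\mathbf{y}\|^2+\frac{46\sigma^2}{n}\log\frac1{\nu_J}\right).$$ *)

(* Defs.v *)
From HB Require Import structures.
From mathcomp Require Import all_boot all_order all_algebra.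
From mathcomp Require Import all_classical all_reals all_analysis.

Set Implicit Arguments.
Unset Strict Implicit.
Unset Printing Implicit Defensive.
Import Order.TTheory GRing.Theory Num.Theory.
Import numFieldNormedType.Exports.
Local Open Scope classical_set_scope.
Local Open Scope ring_scope.

(* Vectors of R^n are row vectors, with coordinates numbered from 0, so the
   index set {2, ..., n-1} of the second-difference constraints becomes
   {1, ..., n-2}. *)

Definition snorm (R : realType) (n : nat) (u : 'rV[R]_n) : R :=
  Num.sqrt (n%:R^-1 * \sum_(i < n) u 0 i ^+ 2).

Definition interior_idx (n : nat) : {set 'I_n} :=
  [set i : 'I_n | (0 < i)%N && (i.+1 < n)%N]%SET.

(* u_{i+1} + u_{i-1}: for i in interior_idx n the cyclic successor and
   predecessor ordS, ord_pred do not wrap around. *)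
Definition nbr_sum (R : realType) (n : nat) (u : 'rV[R]_n) (i : 'I_n) : R :=
  u 0 (ordS i) + u 0 (ord_pred i).

Definition SC (R : realType) (n : nat) : set 'rV[R]_n :=
  [set u : 'rV[R]_n |
    forall i, i \in interior_idx n -> 2 * u 0 i <= nbr_sum u i].

Definition q_of (R : realType) (n : nat) (u : 'rV[R]_n) : nat :=
  #|[set i in interior_idx n | 2 * u 0 i != nbr_sum u i]%SET|.+1.

Definition SCq (R : realType) (n q : nat) : set 'rV[R]_n :=
  [set u : 'rV[R]_n | SC u /\ (q_of u <= q)%N].

Definition HC (R : realType) (n : nat) : R := \sum_(i < n.-1) expR (- i%:R).

Definition nuJ (R : realType) (n : nat) (J : {set 'I_n}) : R :=
  expR (- #|J|%:R) / (HC R n * 'C(n - 2, #|J|)%:R).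

Definition WJ (R : realType) (n : nat) (J : {set 'I_n}) : set 'rV[R]_n :=
  [set u : 'rV[R]_n |
    forall i, i \in interior_idx n :\: J -> 2 * u 0 i = nbr_sum u i].

(* (u *m Wcons J) 0 i is 2 u_i - (u_{i+1} + u_{i-1}) for i in interior_idx n
   outside J and 0 otherwise, so that WJ J is the row space of
   kermx (Wcons J). *)
Definition Wcons (R : realType) (n : nat) (J : {set 'I_n}) : 'M[R]_n :=
  \matrix_(k, i) (if i \in interior_idx n :\: J then
    2 * (k == i)%:R - ((k == ordS i)%:R + (k == ord_pred i)%:R) else 0).

(* Orthogonal projector, acting on row vectors by right multiplication, onto
   the row space of U; the row space of kermx U^T is its orthogonal
   complement. *)
Definition ortho_projmx (R : realType) (n : nat) (U : 'M[R]_n) : 'M[R]_n :=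
  proj_mx U (kermx U^T).

(* The orthogonal projector onto WJ J: see QJ_ortho_projector below. *)
Definition QJ (R : realType) (n : nat) (J : {set 'I_n}) : 'M[R]_n :=
  ortho_projmx (kermx (Wcons R J)).

(* The weights theta and theta' are indexed by the subsets J of
   interior_idx n; their values at the other J : {set 'I_n} are never used. *)
Definition simplex (R : realType) (n : nat) : set ({set 'I_n} -> R) :=
  [set theta : {set 'I_n} -> R |
    (forall J : {set 'I_n}, J \subset interior_idx n -> 0 <= theta J) /\
    \sum_(J : {set 'I_n} | J \subset interior_idx n) theta J = 1].

Definition mu_theta (R : realType) (n : nat) (y : 'rV[R]_n)
    (theta : {set 'I_n} -> R) : 'rV[R]_n :=
  \sum_(J : {set 'I_n} | J \subset interior_idx n) theta J *: (y *m QJ R J).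

Definition Qcrit (R : realType) (n : nat) (sigma : R) (y : 'rV[R]_n)
    (theta : {set 'I_n} -> R) : R :=
  snorm (mu_theta y theta - y) ^+ 2 +
  \sum_(J : {set 'I_n} | J \subset interior_idx n) theta J *
    (2 * sigma ^+ 2 * #|J|%:R / n%:R +
     2^-1 * snorm (mu_theta y theta - y *m QJ R J) ^+ 2 +
     46 * sigma ^+ 2 / n%:R * ln (1 / nuJ R J)).

Definition Qcrit_minimizer (R : realType) (n : nat) (sigma : R) (y : 'rV[R]_n) :
    set ({set 'I_n} -> R) :=
  [set theta : {set 'I_n} -> R | simplex theta /\
    forall theta', simplex theta' ->
      Qcrit sigma y theta <= Qcrit sigma y theta'].

(* The minimizing theta need not be unique; any choice of one is allowed.
   One always exists (Qconv_estimator_exists below). *)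
Definition is_Qconv_estimator (R : realType) (n : nat) (sigma : R)
    (muhat : 'rV[R]_n -> 'rV[R]_n) : Prop :=
  forall y, exists2 theta, Qcrit_minimizer sigma y theta
                         & muhat y = mu_theta y theta.

Definition mutually_independent d (T : measurableType d) (R : realType)
    (P : probability T R) (n : nat) (X : 'I_n -> {RV P >-> R}) : Prop :=
  forall (I : {set 'I_n}) (A : 'I_n -> set R),
    (forall i, measurable (A i)) ->
    P (\bigcap_(i in [set` I]) X i @^-1` A i) =
      (\prod_(i in I) P (X i @^-1` A i))%E.

(* Law N(0, sigma^2 I_n); the second parameter of normal_prob is the standard
   deviation. *)
Definition gaussian_noise d (T : measurableType d) (R : realType)
    (P : probability T R) (n : nat) (sigma : R)
    (xi : 'I_n -> {RV P >-> R}) : Prop :=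
  (forall i (A : set R), measurable A ->
     distribution P (xi i) A = normal_prob 0 sigma A) /\
  mutually_independent xi.

Definition obs d (T : measurableType d) (R : realType)
    (P : probability T R) (n : nat) (xi : 'I_n -> {RV P >-> R})
    (mu : 'rV[R]_n) (w : T) : 'rV[R]_n :=
  mu + \row_i xi i w.

Lemma WJ_kermx (R : realType) (n : nat) (J : {set 'I_n}) (u : 'rV[R]_n) :
  WJ J u <-> (u <= kermx (Wcons R J))%MS.
Proof.
have E i : (u *m Wcons R J) 0 i =
    if i \in interior_idx n :\: J then 2 * u 0 i - nbr_sum u i else 0.
  rewrite mxE; case: ifP => Hi; last first.
    by rewrite big1 // => k _; rewrite mxE Hi mulr0.
  have D j : \sum_(k < n) u 0 k * (k == j)%:R = u 0 j.
    rewrite (bigD1 j) //= eqxx mulr1 big1 ?addr0 // => k /negbTE ->.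
    by rewrite mulr0.
  under eq_bigr do rewrite mxE Hi mulrBr mulrDr mulrCA.
  by rewrite sumrB big_split /= !D -mulr_sumr D.
split => [Wu|/sub_kermxP H i Hi].
  apply/sub_kermxP/rowP => i; rewrite E mxE; case: ifP => // Hi.
  by rewrite Wu // subrr.
by apply/eqP; rewrite -subr_eq0; have := E i; rewrite H mxE Hi => <-.
Qed.

Lemma QJ_ortho_projector (R : realType) (n : nat) (J : {set 'I_n})
    (y : 'rV[R]_n) :
  WJ J (y *m QJ R J) /\
  forall w : 'rV[R]_n, WJ J w -> (y - y *m QJ R J) *m w^T = 0.
Proof.
rewrite /QJ /ortho_projmx; set U := kermx _.
have disj : (U :&: kermx U^T)%MS = 0.
  apply/eqP/rowV0P => v; rewrite sub_capmx => /andP[/submxP[a va]].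
  move=> /sub_kermxP vU; have : (v *m v^T) 0 0 = 0.
    by rewrite {2}va trmx_mul mulmxA vU mul0mx mxE.
  rewrite mxE => /eqP; rewrite psumr_eq0 => [/allP H|i _]; last first.
    by rewrite mxE -expr2 sqr_ge0.
  apply/rowP => i; rewrite mxE; apply/eqP.
  by have := H i; rewrite mem_index_enum mxE mulf_eq0 orbb; apply.
have full : (y <= U + kermx U^T)%MS.
  apply: (submx_trans (submx1 y)).
  rewrite -mxrank_leqif_sup ?submx1 // mxrank1.
  by rewrite mxrank_disjoint_sum // mxrank_ker mxrank_tr subnKC // rank_leq_row.
split; first by apply/WJ_kermx; exact: proj_mx_sub.
move=> w /WJ_kermx/submxP[a ->]; rewrite (trmx_mul a U) mulmxA.
by have /sub_kermxP -> := proj_mx_compl_sub full; rewrite mul0mx.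
Qed.

Lemma snorm2E (R : realType) (n : nat) (u : 'rV[R]_n) :
  snorm u ^+ 2 = n%:R^-1 * \sum_(i < n) u 0 i ^+ 2.
Proof.
rewrite sqr_sqrtr // mulr_ge0 ?invr_ge0 ?ler0n //.
by apply: sumr_ge0 => i _; exact: sqr_ge0.
Qed.

Lemma continuous_add (R : realType) (V : topologicalType) (f g : V -> R) :
  continuous f -> continuous g -> continuous (fun x => f x + g x).
Proof. by move=> cf cg x; apply: cvgD; [exact: cf|exact: cg]. Qed.

Lemma continuous_sub (R : realType) (V : topologicalType) (f g : V -> R) :
  continuous f -> continuous g -> continuous (fun x => f x - g x).
Proof. by move=> cf cg x; apply: cvgB; [exact: cf|exact: cg]. Qed.

Lemma continuous_mul (R : realType) (V : topologicalType) (f g : V -> R) :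
  continuous f -> continuous g -> continuous (fun x => f x * g x).
Proof. by move=> cf cg x; apply: cvgM; [exact: cf|exact: cg]. Qed.

Lemma continuous_const (R : realType) (V : topologicalType) (a : R) :
  continuous (fun _ : V => a).
Proof. by move=> x; exact: cvg_cst. Qed.

Lemma continuous_bigsum (R : realType) (V : topologicalType) (I : Type)
    (s : seq I) (p : pred I) (f : I -> V -> R) :
  (forall i, p i -> continuous (f i)) ->
  continuous (fun x => \sum_(i <- s | p i) f i x).
Proof.
move=> cf x; elim: s => [|i s IH].
  by under eq_fun do rewrite big_nil; exact: cvg_cst.
under eq_fun do rewrite big_cons.
case: ifP => // pi; apply: cvgD => //; exact: cf.
Qed.

Lemma continuous_snorm2 (R : realType) (V : topologicalType) (n : nat)
    (f : V -> 'rV[R]_n) : (forall i, continuous (fun x => f x 0 i)) ->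
  continuous (fun x => snorm (f x) ^+ 2).
Proof.
move=> cf; under eq_fun do rewrite snorm2E.
move=> x; apply: cvgM; first exact: cvg_cst.
apply: continuous_bigsum => i _ {}x.
by under eq_fun do rewrite expr2; apply: cvgM; exact: cf.
Qed.

(* The minima of the two risk bounds are attained, so they are the inf of the
   corresponding sets. *)
Lemma SCq_dist_attained (R : realType) (n q : nat) (mu : 'rV[R]_n) :
  (1 <= q)%N -> exists2 u0 : 'rV[R]_n, SCq q u0 &
    forall u, SCq q u -> snorm (u0 - mu) <= snorm (u - mu).
Proof.
move=> q1; case: (posnP n) => [n0|n0].
  subst n; exists 0 => [|u _]; last by rewrite [u]thinmx0.
  split=> [[]//|]; rewrite /q_of (leq_trans _ q1) // ltnS leqn0 cards_eq0.
  by apply/eqP/setP => -[].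
pose B := [set u : 'rV[R]_n | snorm (u - mu) ^+ 2 <= snorm (0 - mu) ^+ 2].
pose F (J : {set 'I_n}) : set 'rV[R]_n := [set u | SC u /\ WJ J u].
pose A := [set J : {set 'I_n} | (#|J| < q)%N]%SET.
have SCE : @SCq R n q = \bigcup_(J in [set` A]) F J.
  apply/seteqP; split=> u /=.
    move=> [Su qu]; exists [set i in interior_idx n | 2 * u 0 i != nbr_sum u i]%SET.
      by rewrite /= inE.
    by split=> // i /setDP[iI]; rewrite finset.inE iI /= negbK => /eqP.
  move=> [J]; rewrite /= inE => Jq [Su WJu]; split=> //.
  apply: leq_ltn_trans Jq; apply: subset_leq_card; apply/fintype.subsetP => i.
  rewrite finset.inE => /andP[iI]; apply: contraR => iJ.
  by apply/eqP/WJu/setDP.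
have ccoord i : continuous (fun u : 'rV[R]_n => u 0 i).
  exact: coord_continuous.
have cn i : continuous (fun u : 'rV[R]_n => nbr_sum u i).
  exact: continuous_add.
have c2 i : continuous (fun u : 'rV[R]_n => 2 * u 0 i - nbr_sum u i).
  by apply: continuous_sub => //; apply: continuous_mul => //; exact: continuous_const.
have clle (g : 'rV[R]_n -> R) : continuous g -> closed [set u | g u <= 0].
  by move=> cg; apply: (preimage_closed (f := g) (D := [set x : R | x <= 0]));
    [move=> ? _; exact: cg|exact: closed_le].
have cleq (g : 'rV[R]_n -> R) : continuous g -> closed [set u | g u = 0].
  by move=> cg; apply: (preimage_closed (f := g) (D := [set x : R | x = 0]));
    [move=> ? _; exact: cg|exact: closed_eq].
have clF J : closed (F J).
  have -> : F J = (\bigcap_(i in [set` interior_idx n])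
      [set u : 'rV[R]_n | 2 * u 0 i - nbr_sum u i <= 0]) `&`
     (\bigcap_(i in [set` interior_idx n :\: J])
      [set u : 'rV[R]_n | 2 * u 0 i - nbr_sum u i = 0]).
    apply/seteqP; split=> u /=.
      move=> [Su Wu]; split=> i /= iI; first by rewrite subr_le0 Su.
      by rewrite Wu // subrr.
    move=> [Su Wu]; split=> i iI; first by rewrite -subr_le0; exact: Su.
    by apply/eqP; rewrite -subr_eq0; apply/eqP; exact: Wu.
  apply: closedI; apply: closed_bigI => i _; [exact: clle|exact: cleq].
have clS : closed (@SCq R n q).
  by rewrite SCE; apply: closed_bigcup => //; exact: finite_finset.
have cd : continuous (fun u : 'rV[R]_n => snorm (u - mu) ^+ 2).
  apply: continuous_snorm2 => i; under eq_fun do rewrite !mxE.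
  by apply: continuous_add => //; exact: continuous_const.
have clB : closed B.
  have -> : B = [set u : 'rV[R]_n | snorm (u - mu) ^+ 2 - snorm (0 - mu) ^+ 2 <= 0].
    by apply/seteqP; split=> u /=; rewrite subr_le0.
  by apply: clle; apply: continuous_sub => //; exact: continuous_const.
pose M := Num.sqrt (n%:R * snorm (0 - mu) ^+ 2).
have bB : bounded_set B.
  exists (M + `|mu|); split; first exact: num_real.
  move=> x Mx u /= Bu; apply: le_trans (ltW Mx).
  rewrite -[u](subrK mu); apply: (le_trans (ler_normD _ _)).
  rewrite lerD2r /Num.norm /= mx_normrE; apply/bigmax_leP; split.
    exact: sqrtr_ge0.
  move=> [i j] _ /=; rewrite ord1 -sqrtr_sqr; apply: ler_wsqrtr.
  apply: le_trans (_ : n%:R * snorm (u - mu) ^+ 2 <= _); last first.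
    by rewrite ler_pM2l // ltr0n.
  rewrite snorm2E mulrA divff ?mul1r ?pnatr_eq0 -?lt0n //.
  rewrite (bigD1 j) //= lerDl; apply: sumr_ge0 => k _; exact: sqr_ge0.
have S0 : SCq q (0 : 'rV[R]_n).
  split=> [i _|]; first by rewrite /nbr_sum !mxE mulr0 addr0.
  rewrite /q_of (leq_trans _ q1) // ltnS leqn0 cards_eq0; apply/eqP/setP => i.
  by rewrite !finset.inE /nbr_sum !mxE mulr0 addr0 eqxx andbF.
have [|||u0] := @EVT_min_rV R n (fun u => snorm (u - mu) ^+ 2) (@SCq R n q `&` B).
- by exists 0; split; [exact: S0|exact: lexx].
- apply: bounded_closed_compact; last exact: closedI.
  by case: bB => M0 [M0r HM]; exists M0; split=> // x Mx u [_ /(HM x Mx)].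
- exact: continuous_subspaceT.
rewrite inE => -[Su0 Bu0] H; exists u0 => // u Su.
rewrite -ler_sqr ?nnegrE ?sqrtr_ge0 //.
have [uB|/ltW uB] := leP (snorm (u - mu) ^+ 2) (snorm (0 - mu) ^+ 2).
  by apply: H; rewrite inE; split.
exact: le_trans Bu0 uB.
Qed.

Lemma Qcrit_minimizer_exists (R : realType) (n : nat) (sigma : R)
    (y : 'rV[R]_n) : Qcrit_minimizer sigma y !=set0.
Proof.
pose th (t : 'rV[R]_#|{set 'I_n}|) (J : {set 'I_n}) : R := t 0 (enum_rank J).
pose s (t : 'rV[R]_#|{set 'I_n}|) :=
  \sum_(J : {set 'I_n} | J \subset interior_idx n) th t J.
pose Bx : set 'rV[R]_#|{set 'I_n}| := [set t | forall j, t ord0 j \in `[0, 1]].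
pose H : set 'rV[R]_#|{set 'I_n}| := [set t | s t = 1].
have cth J : continuous (fun t => th t J) by exact: coord_continuous.
have cs : continuous s by exact: continuous_bigsum.
have cB : compact Bx.
  rewrite /Bx.
  apply: (@rV_compact R _ (fun=> `[0, 1]%classic)).
  by move=> _; exact: segment_compact.
have cH : closed H.
  by apply: (preimage_closed (f := s) (D := [set x : R | x = 1]));
    [move=> ? _; exact: cs|exact: closed_eq].
have cBH : compact (Bx `&` H) by exact: compact_closedI.
have cm i : continuous (fun t => mu_theta y (th t) 0 i).
  under eq_fun do rewrite summxE; apply: continuous_bigsum => J _.
  under eq_fun do rewrite mxE.
  by apply: continuous_mul => //; exact: continuous_const.
have cmB (z : 'rV[R]_n) :
    continuous (fun t => snorm (mu_theta y (th t) - z) ^+ 2).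
  apply: continuous_snorm2 => i; under eq_fun do rewrite !mxE.
  have := cm i; rewrite /mu_theta => cmi.
  by apply: continuous_add => //; exact: continuous_const.
have cQ : continuous (fun t => Qcrit sigma y (th t)).
  apply: continuous_add => //; apply: continuous_bigsum => J _.
  apply: continuous_mul => //; apply: continuous_add; last first.
    exact: continuous_const.
  apply: continuous_add; first exact: continuous_const.
  by apply: continuous_mul => //; exact: continuous_const.
pose cut (theta : {set 'I_n} -> R) : 'rV[R]_#|{set 'I_n}| :=
  \row_j (let J : {set 'I_n} := enum_val j in
           if J \subset interior_idx n then theta J else 0).
have cutE theta (J : {set 'I_n}) : J \subset interior_idx n ->
    th (cut theta) J = theta J.
  by move=> JI; rewrite /th mxE /= enum_rankK JI.
have cutK theta : simplex theta -> (Bx `&` H) (cut theta).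
  move=> [t0 t1]; split=> [j|]; last first.
    by rewrite /H /s /= -t1; apply: eq_bigr => J; exact: cutE.
  rewrite /= mxE in_itv /=; case: ifP => jI; last by rewrite lexx ler01.
  rewrite t0 //= -t1 (bigD1 (enum_val j : {set 'I_n})) //= lerDl.
  by apply: sumr_ge0 => J /andP[JI _]; exact: t0.
have cutQ theta : Qcrit sigma y (th (cut theta)) = Qcrit sigma y theta.
  have E : mu_theta y (th (cut theta)) = mu_theta y theta.
    by apply: eq_bigr => J JI; rewrite cutE.
  by rewrite /Qcrit E; congr (_ + _); apply: eq_bigr => J JI; rewrite cutE.
have [|t tBH tmin] := EVT_min_rV _ cBH (continuous_subspaceT cQ).
  exists (cut (fun J => (J == finset.set0)%:R)); apply: cutK.
  split=> [J _|]; first exact: ler0n.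
  rewrite (bigD1 finset.set0) ?finset.sub0set //= eqxx big1 ?addr0 //.
  by move=> J /andP[_ /negbTE ->].
move: tBH; rewrite inE => -[tB tH]; exists (th t); split.
  split=> // J _; have := tB (enum_rank J); rewrite in_itv /=.
  by move=> /andP[].
move=> theta' st'; rewrite -(cutQ theta'); apply: tmin; rewrite inE.
exact: cutK.
Qed.

Lemma Qconv_estimator_exists (R : realType) (n : nat) (sigma : R) :
  exists muhat : 'rV[R]_n -> 'rV[R]_n, is_Qconv_estimator sigma muhat.
Proof.
have [f fP] := choice (Qcrit_minimizer_exists (n := n) sigma).
by exists (fun y => mu_theta y (f y)) => y; exists (f y).
Qed.

(* Main.v *)
Require Import Defs.
From mathcomp Require Import all_boot all_order all_algebra.
From mathcomp Require Import all_classical all_reals all_analysis.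
From mathcomp Require Import measurable_realfun ring lra.
Import Order.TTheory GRing.Theory Num.Theory.
Import numFieldNormedType.Exports.
Local Open Scope classical_set_scope.
Local Open Scope ring_scope.
Set Implicit Arguments.
Unset Strict Implicit.

(** The estimator is a Q-aggregate of the projections [a_k = y Q_k].  Since
    [sum_k theta_k |a_k - b|^2] equals [sum_k theta_k |a_k - m|^2 + |m - b|^2]
    for the barycentre [m] of the [a_k], the criterion is
    [|m - y|^2 / 2] plus a linear function of [theta].  Its first-order
    optimality condition in the direction of a vertex [J] reads, with
    [xi = y - mu] and unnormalised norms ([qagg_oracle]),

      [|muhat - mu|^2 <= |a_J - mu|^2 + pen_J
         + sum_k theta_k (2 <a_k - a_J, xi> - |a_k - a_J|^2 / 2 - pen_k)].

    The vector [a_k - a_J] lies in [W_(k u J)], a space of dimension at most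
    [|k| + |J| + 2], so the bracket is at most [2 R_(k u J) - pen_k], where
    [R_A] is the squared norm of the projection of [xi] onto [W_A].  Here
    [pen_k] contains [46 s^2 log (1 / nu_k) >= 46 s^2 |k|], with [s] the
    standard deviation of the noise, and therefore dominates the fluctuations
    of [R_(k u J)] that depend on [k].

    The Gaussian noise satisfies [E exp (R_A / (4 s^2)) <= sqrt 2 ^ (|A| + 2)]
    ([gaussian_sqr_moment]).  The tangent inequality
    [r <= l (t - 1 + exp (r / l - t))] turns the random weights [theta_k] and
    the selection of [k] into a sum over all [k] of such exponentials, weighted
    by [exp (- pen_k / (8 s^2))] ([pointwise_risk]); the
    weights beat the moments and leave a multiple of [sum_k nu_k = 1].  With
    [t = |J| + 2] this gives
    [E |muhat - mu|^2 <= |u - mu|^2 + pen_J + 12 s^2 (|J| + 2)] for every [u] in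
    [W_J] ([risk_majorant]).

    A vector [u] of the class with at most [q - 1] kinks lies in [W_J], where
    [J] is the set of its kinks, and the entropy bound
    ['C(n - 2, |J|) <= (e n / q)^q] shows that the remainder is at most
    [118 s^2 q log (e n / q)] ([pen_le]).  The bound on the unsquared norm
    follows from the squared one by Jensen's inequality in tangent form
    ([sqrt_majorant]).

    The loss is bounded pointwise by an explicit measurable function.  This
    bounds its expectation whether or not the loss is measurable, since the
    integral of a nonnegative function is a supremum over the simple functions
    below it ([ge0_le_integral_lower]). *)

(** * Integrals against laws and densities *)

(** The integral of a nonnegative function is a supremum over the simple functions
    below it.  This form serves the loss of an estimator that is given only as a
    pointwise minimiser. *)
Lemma ge0_le_integral_lower d (T : measurableType d) (R : realType)
    (mu : {measure set T -> \bar R}) (f g : T -> \bar R) :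
  (forall x, 0 <= f x)%E -> (forall x, f x <= g x)%E ->
  (\int[mu]_x f x <= \int[mu]_x g x)%E.
Proof.
move=> f0 fg; have g0 x : (0 <= g x)%E by exact: le_trans (f0 x) (fg x).
rewrite !ge0_integralTE//; apply: le_ereal_sup => _ [h hf <-].
by exists h => // x; exact: le_trans (hf x) (fg x).
Qed.

Import HBNNSimple.

(** The hypothesis says that the law of [phi] under the measure of density [g]
    with respect to [mu] is [nu].  The formula then holds for simple functions
    by linearity, and for [f] by monotone convergence. *)
Lemma integral_comp_density d1 d2 (X : measurableType d1) (Y : measurableType d2)
    (R : realType) (mu : {measure set X -> \bar R})
    (nu : {measure set Y -> \bar R}) (phi : X -> Y) (g : X -> R) (f : Y -> R) :
  measurable_fun setT phi -> measurable_fun setT g -> (forall x, 0 <= g x) ->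
  (forall A, measurable A ->
     (\int[mu]_x (\1_A (phi x) * g x)%:E = nu A)%E) ->
  measurable_fun setT f -> (forall y, 0 <= f y) ->
  (\int[nu]_y (f y)%:E = \int[mu]_x (f (phi x) * g x)%:E)%E.
Proof.
move=> mphi mg g0 munu mf f0.
have mEf : measurable_fun setT (EFin \o f : Y -> \bar R) by exact/measurable_EFinP.
pose h := nnsfun_approx measurableT mEf.
have hf y : (h n y)%:E @[n --> \oo] --> (f y)%:E.
  by apply: (cvg_nnsfun_approx measurableT mEf) => // z _; rewrite lee_fin.
have mgE : measurable_fun setT (EFin \o g : X -> \bar R) by exact/measurable_EFinP.
transitivity (limn (fun n => \int[nu]_y (h n y)%:E))%E.
  rewrite -monotone_convergence//.
  - by apply: eq_integral => y _; apply/esym/cvg_lim => //; exact: hf.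
  - by move=> n; exact/measurable_EFinP/measurable_funP.
  - by move=> n y _; rewrite lee_fin.
  - by move=> y _ m n mn; rewrite lee_fin; exact/lefP/nd_nnsfun_approx.
have mhphi n : measurable_fun setT (fun x => h n (phi x) * g x).
  by apply: measurable_funM => //; exact: measurableT_comp.
transitivity (limn (fun n => \int[mu]_x (h n (phi x) * g x)%:E))%E; last first.
  rewrite -monotone_convergence//.
  - apply: eq_integral => x _; apply/cvg_lim => //; rewrite EFinM.
    under eq_fun do rewrite EFinM.
    by apply: cvgeZr => //; exact: hf.
  - by move=> n; exact/measurable_EFinP.
  - by move=> n x _; rewrite lee_fin mulr_ge0.
  - move=> x _ m n mn; rewrite lee_fin ler_wpM2r//.
    exact/lefP/nd_nnsfun_approx.
congr (limn _); apply/funext => n.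
rewrite integralT_nnsfun sintegralE.
under [RHS]eq_integral => x _.
  rewrite fimfunE EFinM -fsumEFin// ge0_mule_fsuml; last first.
    by move=> r; rewrite nnfun_muleindic_ge0.
  over.
rewrite ge0_integral_fsum//; last 2 first.
- move=> r; apply: emeasurable_funM => //; apply/measurable_EFinP.
  by apply: measurable_funM => //; exact: measurableT_comp.
- move=> r x _; apply: mule_ge0; last by rewrite lee_fin.
  by rewrite EFinM; exact: nnfun_muleindic_ge0.
apply: eq_fsbigr => r _.
under eq_integral do rewrite -EFinM -mulrA EFinM.
have [r0|r0] := leP 0 r; last first.
  rewrite preimage_nnfun0// measure0; transitivity (0%E : \bar R); first exact: mule0.
  by apply/esym/integral0_eq => x _; rewrite indic0 mul0r mule0.
rewrite ge0_integralZl_EFin//.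
- by rewrite munu//; exact: measurable_sfunP.
- by move=> x _; rewrite lee_fin mulr_ge0.
- by apply/measurable_EFinP/measurable_funM => //; exact: measurableT_comp.
Qed.

Lemma integral_normal_prob (R : realType) (m s : R) (f : R -> R) :
  measurable_fun setT f -> (forall y, 0 <= f y) ->
  (\int[normal_prob m s]_y (f y)%:E
   = \int[lebesgue_measure]_x (f x * normal_pdf m s x)%:E)%E.
Proof.
move=> mf f0.
apply: (@integral_comp_density _ _ _ _ R lebesgue_measure (normal_prob m s)
  idfun (normal_pdf m s) f) => //.
- exact: measurable_id.
- exact: measurable_normal_pdf.
- by move=> x; exact: normal_pdf_ge0.
move=> A mA; rewrite /normal_prob [RHS]integral_mkcond/=.
apply: eq_integral => x _; rewrite patchE indicE.
by case: ifP => _; rewrite ?mul1r ?mul0r.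
Qed.

(** Completing the square turns the integrand into a multiple of the density of
    mean [s ^+ 2 * t]. *)
Lemma normal_mgf (R : realType) (s t : R) : s != 0 ->
  (\int[normal_prob 0 s]_y (expR (t * y))%:E
   = (expR (s ^+ 2 * t ^+ 2 / 2))%:E)%E.
Proof.
move=> s0; rewrite integral_normal_prob => [|| y]; last exact: expR_ge0; last first.
  by apply: measurableT_comp => //; exact: measurable_funM.
transitivity (\int[lebesgue_measure]_x ((expR (s ^+ 2 * t ^+ 2 / 2))%:E *
    (normal_pdf (s ^+ 2 * t) s x)%:E))%E.
  apply: eq_integral => x _; rewrite -EFinM; congr EFin.
  rewrite !normal_pdfE// /normal_fun mulrCA [RHS]mulrCA -!expRD.
  by congr (_ * expR _); field.
rewrite ge0_integralZl_EFin//.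
- by rewrite integral_normal_pdf mule1.
- by move=> x _; rewrite lee_fin normal_pdf_ge0.
- by apply/measurable_EFinP; exact: measurable_normal_pdf.
Qed.

(** The integrand times the standard density is [sqrt 2] times the density of
    variance 2. *)
Lemma normal_exp_sqr (R : realType) :
  (\int[normal_prob 0 1]_y (expR (y ^+ 2 / 4))%:E = (Num.sqrt 2 : R)%:E)%E.
Proof.
rewrite integral_normal_prob => [|| y]; last exact: expR_ge0; last first.
  by apply: measurableT_comp => //; exact: measurable_funM.
transitivity (\int[lebesgue_measure]_x ((Num.sqrt 2 : R)%:E *
    (normal_pdf (0 : R) (Num.sqrt 2) x)%:E))%E.
  apply: eq_integral => x _; rewrite -EFinM; congr EFin.
  rewrite !normal_pdfE ?gt_eqF ?sqrtr_gt0// /normal_fun /normal_peak.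
  rewrite sqr_sqrtr// mulrCA -expRD !mulrA; congr (_ * expR _); last by field.
  rewrite -!mulrnAr expr1n mul1r sqrtrM// invfM mulrA divff ?mul1r//.
rewrite ge0_integralZl_EFin//.
- by rewrite integral_normal_pdf mule1.
- by move=> x _; rewrite lee_fin normal_pdf_ge0.
- by apply/measurable_EFinP; exact: measurable_normal_pdf.
Qed.
Lemma measurable_fun_prod_cond d (T : measurableType d) (R : realType)
    (I : Type) (s : seq I) (p : pred I) (f : I -> T -> R) :
  (forall i, measurable_fun setT (f i)) ->
  measurable_fun setT (fun x => \prod_(i <- s | p i) f i x).
Proof.
move=> mf; elim: s => [|i s IH].
  by under eq_fun do rewrite big_nil; exact: measurable_cst.
have [pi|/negbTE pi] := boolP (p i).
  by under eq_fun do rewrite big_cons pi; exact: measurable_funM.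
by under eq_fun do rewrite big_cons pi.
Qed.

(** Independence is given on events, that is, for indicators.  The indicators are
    exchanged for general functions one coordinate at a time: with the other
    factors fixed, both sides are measures in the current coordinate that
    agree on measurable sets. *)
Lemma prod_indep d (T : measurableType d) (R : realType) (P : probability T R)
    (n : nat) (X : 'I_n -> {RV P >-> R}) (f : 'I_n -> R -> R) (c : 'I_n -> R) :
  mutually_independent X ->
  (forall i, measurable_fun setT (f i)) -> (forall i x, 0 <= f i x) ->
  (forall i, \int[P]_w (f i (X i w))%:E = (c i)%:E)%E ->
  (\int[P]_w (\prod_i f i (X i w))%:E = (\prod_i c i)%:E)%E.
Proof.
move=> indX mf f0 fc.
suff H : forall k (f : 'I_n -> R -> R) (c : 'I_n -> R),
    (forall i, measurable_fun setT (f i)) -> (forall i x, 0 <= f i x) ->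
    (forall i, \int[P]_w (f i (X i w))%:E = (c i)%:E)%E ->
    (forall i : 'I_n, (k <= i)%N -> exists2 A, measurable A & f i = \1_A) ->
    (\int[P]_w (\prod_i f i (X i w))%:E = (\prod_i c i)%:E)%E.
  by apply: (H n) => // i; rewrite leqNgt ltn_ord.
move=> k {mf f0 fc}; elim: k => [|k IH] {}f {}c mf f0 fc fI.
  have /choice[A AP] : forall i, exists A, measurable A /\ f i = \1_A.
    by move=> i; have [A mA fA] := fI i isT; exists A.
  have mXA i : measurable (X i @^-1` A i).
    by rewrite -[_ @^-1` _]setTI; apply: measurable_funP => //; exact: (AP i).1.
  have cE i : (c i)%:E = P (X i @^-1` A i).
    by rewrite -fc (AP i).2 -[LHS]/(\int[P]_w (\1_(X i @^-1` A i) w)%:E)%E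
      integral_indic// setIT.
  have -> : (\prod_i c i)%:E = (\prod_(i in [set: 'I_n]%SET) P (X i @^-1` A i))%E.
    rewrite -prodEFin; apply: eq_big => [i|i _]; first by rewrite finset.inE.
    exact: cE.
  rewrite -indX; last by move=> i; exact: (AP i).1.
  have mB : measurable (\bigcap_(i in [set` [set: 'I_n]%SET]) X i @^-1` A i).
    by apply: fin_bigcap_measurable => //; exact: finite_finset.
  set B := \bigcap_(i in _) _ in mB *.
  transitivity (\int[P]_w (\1_B w)%:E)%E; last by rewrite integral_indic// setIT.
  apply: eq_integral => w _.
  congr EFin; under eq_bigr do rewrite (AP _).2 indicE.
  rewrite indicE; have [wB|wB] := boolP (w \in _).
    apply: big1 => i _; rewrite mem_set//.
    by move: wB; rewrite inE; apply; rewrite /= finset.inE.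
  apply/eqP; apply/prodf_eq0.
  have [i /negP wi] : exists i, ~ (X i w \in A i).
    apply/existsNP => wA; move/negP: wB; apply; rewrite inE => i _ /=.
    by have := wA i; rewrite inE.
  by exists i => //; rewrite (negbTE wi).
have [kn|nk] := ltnP k n; last first.
  by apply: IH => // i ki; have := leq_trans nk ki; rewrite leqNgt ltn_ord.
pose i0 := Ordinal kn.
have c0 i : 0 <= c i.
  by rewrite -lee_fin -fc integral_ge0// => w _; rewrite lee_fin.
have C0 : 0 <= \prod_(i | i != i0) c i by exact: prodr_ge0.
pose C : {nonneg R} := NngNum C0.
pose nu := mscale C (distribution P (X i0)).
pose g w := \prod_(i | i != i0) f i (X i w).
have mX i : measurable_fun setT (X i) by exact: measurable_funP.
have mg : measurable_fun setT g.
  by apply: measurable_fun_prod_cond => i; exact: measurableT_comp.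
have munu A : measurable A -> (\int[P]_w (\1_A (X i0 w) * g w)%:E = nu A)%E.
  move=> mA; pose f' i := if i == i0 then \1_A : R -> R else f i.
  pose c' i := if i == i0 then fine (P (X i0 @^-1` A)) else c i.
  have mXA : measurable (X i0 @^-1` A) by rewrite -[_ @^-1` _]setTI; exact: mX.
  have := IH f' c'; rewrite [X in _ -> _ -> _ -> _ -> _ = X%:E](bigD1 i0)//=.
  rewrite {2}/c' eqxx.
  have -> : \prod_(i | i != i0) c' i = \prod_(i | i != i0) c i.
    by apply: eq_bigr => i /negbTE ii; rewrite /c' ii.
  rewrite EFinM fineK; last by exact: fin_num_measure.
  rewrite /nu /mscale /= muleC => <-.
  - apply: eq_integral => w _; rewrite (bigD1 i0)//= /f' eqxx; congr (_ * _)%:E.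
    by apply: eq_bigr => i /negbTE ii; rewrite ii.
  - by move=> i; rewrite /f'; case: eqP => // _; exact: measurable_indic.
  - by move=> i x; rewrite /f'; case: eqP => // _; rewrite indicE.
  - move=> i; rewrite /f' /c'; case: eqP => [->|//].
    rewrite fineK; last by exact: fin_num_measure.
    by rewrite -[LHS]/(\int[P]_w (\1_(X i0 @^-1` A) w)%:E)%E integral_indic// setIT.
  - move=> i ki; rewrite /f'; case: eqP => [_|/eqP ii]; first by exists A.
    by apply: fI; rewrite ltn_neqAle ki andbT eq_sym.
have := integral_comp_density (mX i0) mg _ munu (mf i0) (f0 i0).
rewrite ge0_integral_mscale//; last 2 first.
- exact/measurable_EFinP.
- by move=> x _; rewrite lee_fin.
rewrite ge0_integral_distribution => [||x]; last 2 first.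
- exact/measurable_EFinP.
- by rewrite lee_fin.
rewrite fc => E; rewrite (bigD1 i0)//= mulrC EFinM E//.
  by apply: eq_integral => w _; rewrite (bigD1 i0).
by move=> w; exact: prodr_ge0.
Qed.

Lemma gaussian_linear_mgf d (T : measurableType d) (R : realType)
    (P : probability T R) (n : nat) (s : R) (xi : 'I_n -> {RV P >-> R})
    (w : 'rV[R]_n) : s != 0 -> gaussian_noise s xi ->
  (\int[P]_x (expR (\sum_i w 0 i * xi i x))%:E
   = (expR (s ^+ 2 * (\sum_i w 0 i ^+ 2) / 2))%:E)%E.
Proof.
move=> s0 [xiN xiI].
rewrite mulr_sumr mulr_suml expR_sum.
rewrite -(@prod_indep _ _ _ _ _ xi (fun i x => expR (w 0 i * x)))//.
- by apply: eq_integral => x _; rewrite expR_sum.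
- by move=> i; apply: measurableT_comp => //; exact: measurable_funM.
move=> i; rewrite -normal_mgf//.
have mxi : measurable_fun setT (xi i) by exact: measurable_funP.
rewrite (@integral_comp_density _ _ T (measurableTypeR R) R P (normal_prob 0 s)
  (xi i) (cst 1) (fun y => expR (w 0 i * y))).
- by under [RHS]eq_integral do rewrite /= mulr1.
- exact: mxi.
- exact: measurable_cst.
- by move=> x; exact: ler01.
- move=> A mA; transitivity (distribution P (xi i) A); last exact: xiN.
  have mXA : measurable (xi i @^-1` A) by rewrite -[_ @^-1` _]setTI; exact: mxi.
  transitivity (\int[P]_x (\1_(xi i @^-1` A) x)%:E)%E.
    by apply: eq_integral => x _; rewrite mulr1.
  by rewrite integral_indic// setIT.
- by apply: measurableT_comp => //; exact: measurable_funM.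
- by move=> y; exact: expR_ge0.
Qed.

(** * Scalar products and Gaussian quadratic moments *)

Lemma integralZl_nneg d (T : measurableType d) (R : realType)
    (mu : {measure set T -> \bar R}) (k : R) (f : T -> R) :
  0 <= k -> (forall x, 0 <= f x) -> measurable_fun setT f ->
  (\int[mu]_x (k * f x)%:E = k%:E * \int[mu]_x (f x)%:E)%E.
Proof.
move=> k0 f0 mf; under eq_integral do rewrite EFinM.
apply: ge0_integralZl_EFin => //; first by move=> x _; rewrite lee_fin.
exact/measurable_EFinP.
Qed.

Section Dot.
Variables (R : realType) (n : nat).
Implicit Types (u v w : 'rV[R]_n) (a : R).

Definition dot u v : R := \sum_i u 0 i * v 0 i.

Lemma dotC u v : dot u v = dot v u.
Proof. by apply: eq_bigr => i _; rewrite mulrC. Qed.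

Lemma dotDl u v w : dot (u + v) w = dot u w + dot v w.
Proof. by rewrite -big_split; apply: eq_bigr => i _; rewrite mxE mulrDl. Qed.

Lemma dotZl a u v : dot (a *: u) v = a * dot u v.
Proof. by rewrite mulr_sumr; apply: eq_bigr => i _; rewrite mxE mulrA. Qed.

Lemma dotDr u v w : dot u (v + w) = dot u v + dot u w.
Proof. by rewrite !(dotC u) dotDl. Qed.

Lemma dotZr a u v : dot u (a *: v) = a * dot u v.
Proof. by rewrite !(dotC u) dotZl. Qed.

Lemma dotNl u v : dot (- u) v = - dot u v.
Proof. by rewrite -scaleN1r dotZl mulN1r. Qed.

Lemma dotBl u v w : dot (u - v) w = dot u w - dot v w.
Proof. by rewrite dotDl dotNl. Qed.

Lemma dotBr u v w : dot u (v - w) = dot u v - dot u w.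
Proof. by rewrite !(dotC u) dotBl. Qed.

Lemma dot_suml (I : Type) (r : seq I) (p : pred I) (F : I -> 'rV[R]_n) v :
  dot (\sum_(k <- r | p k) F k) v = \sum_(k <- r | p k) dot (F k) v.
Proof.
rewrite exchange_big; apply: eq_bigr => i _ /=.
by rewrite summxE mulr_suml.
Qed.

Lemma dot_ge0 u : 0 <= dot u u.
Proof. by apply: sumr_ge0 => i _; rewrite -expr2 sqr_ge0. Qed.

Lemma dot_eq0 u : dot u u = 0 -> u = 0.
Proof.
move=> /eqP; rewrite psumr_eq0 => [/allP u0|i _]; last first.
  by rewrite -expr2 sqr_ge0.
apply/rowP => i; rewrite mxE; apply/eqP.
by have := u0 i (mem_index_enum _); rewrite mulf_eq0 orbb.
Qed.

Lemma dot_mx u v : dot u v = (u *m v^T) 0 0.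
Proof. by rewrite mxE; apply: eq_bigr => i _; rewrite mxE. Qed.

Definition orthonormal (b : seq 'rV[R]_n) : bool :=
  all (fun v => dot v v == 1) b && pairwise (fun u v => dot u v == 0) b.

End Dot.

Section GaussianMoment.
Context d (T : measurableType d) (R : realType) (P : probability T R).
Variables (n : nat) (s : R) (xi : 'I_n -> {RV P >-> R}).
Hypotheses (s0 : 0 < s) (xiG : gaussian_noise s xi).

Let X (x : T) : 'rV[R]_n := \row_i xi i x.

Lemma measurable_dot_noise v : measurable_fun setT (fun x => dot v (X x)).
Proof.
apply: measurable_sum => i; apply: measurable_funM => //.
by rewrite /X; under eq_fun do rewrite mxE; exact: measurable_funP.
Qed.

Lemma measurable_sqr_dot_noise (b : seq 'rV[R]_n) :
  measurable_fun setT (fun x => \sum_(v <- b) dot v (X x) ^+ 2).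
Proof.
by apply: measurable_sum => v; apply: measurable_funX; exact: measurable_dot_noise.
Qed.

(** Squares are linearised with one auxiliary standard Gaussian [y] per basis
    vector: [exp (z^2 / (4 s^2))] is the mean of [exp (y z / (sqrt 2 s))].  After
    exchanging the integrals, the shift [y v / (sqrt 2 s)] is absorbed by the linear
    term [w]; this is why the statement carries such a term.  Orthogonality makes
    [dot w w] additive, so that each basis vector costs the factor
    [E exp (y^2 / 4) = sqrt 2]. *)
Lemma gaussian_sqr_moment (b : seq 'rV[R]_n) (w : 'rV[R]_n) :
  orthonormal b -> {in b, forall v, dot v w = 0} ->
  (\int[P]_x (expR ((\sum_(v <- b) dot v (X x) ^+ 2) / (4 * s ^+ 2)
                    + dot w (X x)))%:E
   <= (Num.sqrt 2 ^+ size b * expR (s ^+ 2 * dot w w / 2))%:E)%E.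
Proof.
have sN0 : s != 0 by rewrite gt_eqF.
have r2 : (Num.sqrt 2 : R) != 0 by rewrite gt_eqF ?sqrtr_gt0.
elim: b w => [|v b IH] w.
  move=> _ _; rewrite /= expr0 mul1r.
  under eq_integral do rewrite big_nil mul0r add0r.
  rewrite -[X in expR (_ * X / 2)]/(\sum_i w 0 i * w 0 i).
  under [X in expR (_ * X / 2)]eq_bigr do rewrite -expr2.
  rewrite -(gaussian_linear_mgf w sN0 xiG).
  rewrite le_eqVlt; apply/orP; left; apply/eqP; apply: eq_integral => x _.
  by congr (expR _)%:E; apply: eq_bigr => i _; rewrite mxE.
rewrite /orthonormal /= -andbA => /and4P[/eqP vv b1 /allP vb bb] wb.
pose F x := (\sum_(v <- b) dot v (X x) ^+ 2) / (4 * s ^+ 2) + dot w (X x).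
pose G x := dot v (X x) / (Num.sqrt 2 * s).
pose N := normal_prob (0 : R) 1.
have mF : measurable_fun setT F.
  apply: measurable_funD; last exact: measurable_dot_noise.
  by apply: measurable_funM => //; exact: measurable_sqr_dot_noise.
have mG : measurable_fun setT G.
  by apply: measurable_funM => //; exact: measurable_dot_noise.
pose K (z : T * measurableTypeR R) : \bar R := (expR (F z.1 + G z.1 * z.2))%:E.
have mK : measurable_fun setT K.
  apply/measurable_EFinP/measurableT_comp => //; apply: measurable_funD.
    exact: measurableT_comp.
  by apply: measurable_funM => //; exact: measurableT_comp.
have K0 z : (0 <= K z)%E by rewrite lee_fin expR_ge0.
have -> : (\int[P]_x (expR ((\sum_(v <- v :: b) dot v (X x) ^+ 2) / (4 * s ^+ 2)
                    + dot w (X x)))%:E = \int[P]_x \int[N]_y K (x, y))%E.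
  apply: eq_integral => x _; rewrite /K /=.
  under eq_integral do rewrite expRD.
  rewrite integralZl_nneg; last first.
  - by apply: measurableT_comp => //; exact: measurable_funM.
  - by move=> y; exact: expR_ge0.
  - exact: expR_ge0.
  rewrite normal_mgf ?oner_eq0// -EFinM -expRD; congr (expR _)%:E.
  rewrite big_cons /F /G expr1n mul1r expr_div_n exprMn sqr_sqrtr//.
  by field.
rewrite (fubini_tonelli K)//.
have sqE (y : R) : dot (w + (y / (Num.sqrt 2 * s)) *: v) (w + (y / (Num.sqrt 2 * s)) *: v)
    = dot w w + y ^+ 2 / (2 * s ^+ 2).
  rewrite dotDl !dotDr !dotZl !dotZr vv (dotC w v).
  rewrite (wb v (mem_head _ _)).
  rewrite !mulr0 addr0 add0r mulr1 -expr2 expr_div_n exprMn sqr_sqrtr//.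
apply: (@le_trans _ _ (\int[N]_y (Num.sqrt 2 ^+ size b * expR (s ^+ 2 * dot w w / 2)
    * expR (y ^+ 2 / 4))%:E))%E.
  apply: ge0_le_integral_lower => y.
    by apply: integral_ge0 => x _.
  have := IH (w + (y / (Num.sqrt 2 * s)) *: v).
  rewrite /orthonormal b1 bb sqE => /(_ isT) IH'.
  apply: le_trans (le_trans (IH' _) _).
  - rewrite le_eqVlt; apply/orP; left; apply/eqP; apply: eq_integral => x _.
    congr (expR _)%:E; rewrite /F /G dotDl dotZl.
    by rewrite -[LHS]addrA; congr (_ + (_ + _)); rewrite mulrAC [RHS]mulrAC (mulrC y).
  - move=> u ub; rewrite dotDr dotZr wb ?inE ?ub ?orbT//.
    by rewrite dotC (eqP (vb u ub)) mulr0 addr0.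
  - rewrite lee_fin -[leRHS]mulrA -expRD le_eqVlt; apply/orP; left; apply/eqP.
    by congr (_ * expR _); field.
rewrite integralZl_nneg; last 3 first.
- by rewrite mulr_ge0 ?exprn_ge0 ?expR_ge0// sqrtr_ge0.
- by move=> y; exact: expR_ge0.
- by apply: measurableT_comp => //; exact: measurable_funM.
rewrite normal_exp_sqr -EFinM lee_fin.
by rewrite [leLHS]mulrC mulrA -exprS.
Qed.

End GaussianMoment.

(** * Orthonormal bases of the spaces of piecewise linear vectors *)

Section Subspaces.
Variables (R : realType) (n : nat).
Implicit Types (u v w x : 'rV[R]_n) (J A : {set 'I_n}).

(** Gram-Schmidt: split off a unit vector [v] of [U] and recurse into the
    orthogonal complement of [v] in [U], whose rank is one less. *)
Lemma orthonormal_basis (U : 'M[R]_n) : exists b : seq 'rV[R]_n,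
  [/\ orthonormal b, size b = \rank U, {in b, forall v, (v <= U)%MS} &
      forall x, (x <= U)%MS -> x = \sum_(v <- b) dot x v *: v].
Proof.
move: {2}(\rank U) (erefl (\rank U)) => r; elim: r U => [|r IH] U rU.
  exists [::]; split=> // x; move/eqP: rU; rewrite mxrank_eq0 => /eqP ->.
  by rewrite submx0 big_nil => /eqP.
have [v0 v0U v00] : exists2 v0 : 'rV[R]_n, (v0 <= U)%MS & v0 != 0.
  exists (nz_row U); first exact: nz_row_sub.
  by rewrite nz_row_eq0 -mxrank_eq0 rU.
have v0gt : 0 < dot v0 v0.
  rewrite lt_neqAle dot_ge0 andbT; apply: contraNneq v00 => /esym/dot_eq0 ->.
  exact: eqxx.
pose v := (Num.sqrt (dot v0 v0))^-1 *: v0.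
have vU : (v <= U)%MS by exact: scalemx_sub.
have vv : dot v v = 1.
  rewrite /v dotZl dotZr mulrA -invfM -expr2 sqr_sqrtr ?dot_ge0// mulVf//.
  by rewrite gt_eqF.
pose U' := (U :&: kermx v^T)%MS.
have inU' x : (x <= U')%MS = (x <= U)%MS && (dot x v == 0).
  rewrite sub_capmx; congr (_ && _); apply/sub_kermxP/eqP => [xv|xv].
    by rewrite dot_mx xv mxE.
  by apply/matrixP => i j; rewrite !ord1 -dot_mx xv mxE.
have rU' : \rank U' = r.
  suff r1 : \rank (U *m v^T) = 1%N.
    by have := mxrank_mul_ker U v^T; rewrite r1 rU add1n => -[].
  apply/eqP; rewrite eqn_leq rank_leq_col lt0n mxrank_eq0.
  apply/eqP => Uv0; have /submxP[a va] := vU.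
  have : dot v v = 0 by rewrite dot_mx {1}va -mulmxA Uv0 mulmx0 mxE.
  by rewrite vv => /eqP; rewrite oner_eq0.
have [b [/andP[b1 bb] sb bU bE]] := IH U' rU'.
exists (v :: b); split.
- rewrite /orthonormal /= vv eqxx b1 bb !andbT /=.
  by apply/allP => u /bU; rewrite inU' dotC => /andP[].
- by rewrite /= sb rU' rU.
- move=> u; rewrite inE => /predU1P[->//|/bU].
  by rewrite inU' => /andP[].
move=> x xU; rewrite big_cons; apply/eqP; rewrite addrC -subr_eq; apply/eqP.
rewrite {1}(bE (x - dot x v *: v)).
  rewrite big_seq [RHS]big_seq; apply: eq_bigr => u /bU.
  by rewrite inU' dotBl dotZl (dotC v u) => /andP[_ /eqP ->]; rewrite mulr0 subr0.
rewrite inU' addmx_sub//=; last by rewrite eqmx_opp scalemx_sub.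
by rewrite dotBl dotZl vv mulr1 subrr.
Qed.

(** A vector of [WJ A] is determined by its first two coordinates and by those
    that follow an index of [A]: every other coordinate is given by the linear
    recurrence. *)
Lemma rank_WJ A : (3 <= n)%N -> (\rank (kermx (Wcons R A)) <= #|A| + 2)%N.
Proof.
move=> n3; have n1 : (1 < n)%N by exact: leq_trans n3.
pose i0 : 'I_n := Ordinal (ltnW n1); pose i1 : 'I_n := Ordinal n1.
pose S := (i0 |: (i1 |: [set ordS i | i in A]))%SET.
have cS : (#|S| <= #|A| + 2)%N.
  rewrite addn2 -add1n -[X in (1 + X)%N]add1n !cardsU1.
  apply: leq_add; first exact: leq_b1.
  by apply: leq_add; [exact: leq_b1|exact: leq_imset_card].
apply: leq_trans cS.
pose B : 'M[R]_(n, #|S|) := \matrix_(k, j) (k == enum_val j)%:R.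
have K0 : (kermx (Wcons R A) :&: kermx B)%MS = 0.
  apply/eqP/rowV0P => u; rewrite sub_capmx => /andP[/WJ_kermx uA /sub_kermxP uB].
  have uS i : i \in S -> u 0 i = 0.
    move=> iS; have := congr1 (fun M : 'rV_#|S| => M 0 (enum_rank_in iS i)) uB.
    rewrite !mxE (bigD1 i)//= mxE enum_rankK_in// eqxx mulr1 big1 ?addr0//.
    by move=> k ki; rewrite mxE enum_rankK_in// (negbTE ki) mulr0.
  have : forall m (i : 'I_n), (i <= m)%N -> u 0 i = 0.
    elim=> [|m IH] i im.
      by apply: uS; rewrite !finset.inE -val_eqE/= -leqn0 im.
    move: im; rewrite leq_eqVlt => /predU1P[im|]; last by rewrite ltnS => /IH.
    case: m => [|m] in IH im.
      by apply: uS; rewrite !finset.inE -!val_eqE/= im orbT.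
    have mn : (m.+1 < n)%N by rewrite (leq_trans _ (ltn_ord i))// im.
    pose j := Ordinal mn.
    have Sj : ordS j = i.
      by apply: val_inj; rewrite /= modn_small// -im.
    have [jA|jA] := boolP (j \in A).
      by apply: uS; rewrite !finset.inE -Sj imset_f ?orbT.
    have := uA j; rewrite finset.inE jA finset.inE /= -im ltn_ord => /(_ isT).
    have Sj' : ordS (Ordinal (ltnW mn)) = j.
      by apply: val_inj; rewrite /= modn_small.
    rewrite /nbr_sum Sj -Sj' ordSK Sj' (IH j)// (IH (Ordinal (ltnW mn)))//=.
    by rewrite mulr0 addr0 => <-.
  by move=> u0; apply/rowP => i; rewrite mxE (u0 i i).
have := mxrank_mul_ker (kermx (Wcons R A)) B; rewrite K0 mxrank0 addn0 => <-.
exact: rank_leq_col.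
Qed.

End Subspaces.

(** * Projections *)

Section ProjectionBounds.
Variables (R : realType) (n : nat).
Implicit Types (u v w x y : 'rV[R]_n) (J A B : {set 'I_n}).

Lemma WJ_lin A a u v : WJ A u -> WJ A v -> WJ A (a *: u + v).
Proof.
by move=> /WJ_kermx uA /WJ_kermx vA; apply/WJ_kermx; rewrite addmx_sub ?scalemx_sub.
Qed.

Lemma WJ_sub A B u : A \subset B -> WJ A u -> WJ B u.
Proof.
move=> /fintype.subsetP AB uA i; rewrite finset.inE => /andP[iB iI].
by apply: uA; rewrite finset.inE iI andbT; apply: contra iB; exact: AB.
Qed.

Lemma dot_resid_proj J y w : WJ J w -> dot (y - y *m QJ R J) w = 0.
Proof. by move=> wJ; rewrite dot_mx (QJ_ortho_projector J y).2// mxE. Qed.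

(** For an orthonormal basis [b], the sum of squares is the squared norm of the
    projection of [z], hence the maximum of the left-hand side over [x].  In
    this variational form the bound applies directly to scalar products with the
    noise. *)
Lemma WJ_basis A : (3 <= n)%N -> exists b : seq 'rV[R]_n,
  [/\ orthonormal b, (size b <= #|A| + 2)%N &
      forall x z, WJ A x -> 2 * dot x z - dot x x <= \sum_(v <- b) dot v z ^+ 2].
Proof.
move=> n3; have [b [ob sb _ bE]] := orthonormal_basis (kermx (Wcons R A)).
exists b; split=> // [|x z /WJ_kermx /bE xE]; first by rewrite sb rank_WJ.
rewrite {1 2}xE !dot_suml mulr_sumr -sumrB; apply: ler_sum => v _.
rewrite !dotZl (dotC v x) -subr_ge0.
rewrite [X in 0 <= X](_ : _ = (dot v z - dot x v) ^+ 2); last by ring.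
exact: sqr_ge0.
Qed.

(** With [p] the projection of [mu + xi] and [e = p - u], the residual is
    orthogonal to [e], whence
    [|p - mu|^2 = |u - mu|^2 + 2 <e, xi> - |e|^2]. *)
Lemma proj_loss J mu xi u (B : R) : WJ J u ->
  (forall x, WJ J x -> 2 * dot x xi - dot x x <= B) ->
  dot ((mu + xi) *m QJ R J - mu) ((mu + xi) *m QJ R J - mu)
    <= dot (u - mu) (u - mu) + B.
Proof.
move=> uJ HB; set p := _ *m _.
have pJ : WJ J p by exact: (QJ_ortho_projector J (mu + xi)).1.
have eJ : WJ J (p - u) by rewrite addrC -scaleN1r; exact: WJ_lin.
have := dot_resid_proj (mu + xi) eJ; have := HB _ eJ; rewrite -/p.
rewrite !(dotBl, dotBr, dotDl, dotDr, dotNl) (dotC u p) (dotC mu p) (dotC mu u).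
rewrite (dotC xi p) (dotC xi u).
by move=> h1 h2; lra.
Qed.

End ProjectionBounds.

(** Divide by [t] and let it tend to 0; at [t = - g / (2 * D - g)] a
    negative [g] is already contradicted. *)
Lemma slope_ge0 (R : realType) (g D : R) : 0 <= D ->
  (forall t, 0 <= t -> t <= 1 -> 0 <= t * g + t ^+ 2 * D) -> 0 <= g.
Proof.
move=> D0 H; rewrite leNgt; apply/negP => g0.
have Dg : 0 < 2 * D - g by lra.
have := H (- g / (2 * D - g)).
rewrite divr_ge0 ?ler_pdivrMr ?mul1r//; [|lra..] => /(_ isT).
have -> : - g <= 2 * D - g by lra.
move=> /(_ isT).
rewrite [X in 0 <= X](_ : _ = - g ^+ 2 / (2 * D - g) ^+ 2 * (D - g)); last first.
  by field; rewrite gt_eqF.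
apply/negP; rewrite -ltNge mulNr mulNr oppr_lt0 mulr_gt0//; last lra.
by apply: divr_gt0; [rewrite exprn_even_gt0//= lt_eqF|exact: exprn_gt0].
Qed.

(** * Q-aggregation *)

Section QAggregation.
Variables (R : realType) (n : nat) (K : finType) (p : pred K).
Variables (a : K -> 'rV[R]_n) (pen : K -> R) (y : 'rV[R]_n).
Implicit Types (th : K -> R) (b mu : 'rV[R]_n).

Let weights th := (forall k, p k -> 0 <= th k) /\ \sum_(k | p k) th k = 1.
Let m th := \sum_(k | p k) th k *: a k.
Let sq b := dot b b.
Let crit th := sq (m th - y) +
  \sum_(k | p k) th k * (2^-1 * sq (m th - a k) + pen k).

(** Huygens' formula for the moment of inertia about a point [b]. *)
Lemma barycentre_sq th b : \sum_(k | p k) th k = 1 ->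
  \sum_(k | p k) th k * sq (a k - b)
  = \sum_(k | p k) th k * sq (m th - a k) + sq (m th - b).
Proof.
move=> th1; have sumd c : \sum_(k | p k) th k * dot (a k) c = dot (m th) c.
  by rewrite dot_suml; apply: eq_bigr => k _; rewrite dotZl.
have E k : sq (a k - b) = sq (m th - a k) + 2 * dot (a k) (m th - b)
    + (sq b - sq (m th)).
  by rewrite /sq !(dotBl, dotBr) (dotC b) (dotC (m th) (a k)); ring.
under eq_bigr do rewrite E mulrDr (mulrDr _ (sq _)).
rewrite !big_split /= -addrA; congr (_ + _).
under eq_bigr do rewrite mulrCA.
rewrite -mulr_sumr sumd -mulr_suml th1 mul1r /sq !(dotBl, dotBr) (dotC b).
by ring.
Qed.

(** Moving [th] towards the vertex [j] changes the criterion by [t * g + O(t^2)],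
    so [g >= 0]; everything else is bilinear algebra. *)
Lemma qagg_oracle th j mu : weights th -> p j ->
  (forall th', weights th' -> crit th <= crit th') ->
  sq (m th - mu) <= sq (a j - mu) + pen j +
    \sum_(k | p k) th k * (2 * dot (a k - a j) (y - mu)
                           - 2^-1 * sq (a k - a j) - pen k).
Proof.
move=> wth pj thmin; have [th0 th1] := wth.
pose c k := 2^-1 * sq (a k - y) + pen k.
have halfS th' (F : K -> R) : \sum_(k | p k) th' k * (2^-1 * F k + pen k) =
    2^-1 * (\sum_(k | p k) th' k * F k) + \sum_(k | p k) th' k * pen k.
  under eq_bigr do rewrite mulrDr mulrCA.
  by rewrite big_split /= -mulr_sumr.
have critE th' : \sum_(k | p k) th' k = 1 ->
    crit th' = 2^-1 * sq (m th' - y) + \sum_(k | p k) th' k * c k.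
  move=> th1'; have := barycentre_sq y th1'; rewrite /crit /c !halfS => ->; lra.
pose L := \sum_(k | p k) th k * c k.
pose g := dot (m th - y) (a j - m th) + c j - L.
have g0 : 0 <= g.
  apply: (@slope_ge0 _ _ (2^-1 * sq (a j - m th))).
    by rewrite mulr_ge0// dot_ge0.
  (* the segment from th to the vertex j *)
  move=> t t0 t1; pose tht k := (1 - t) * th k + t * (k == j)%:R.
  have pick (V : lmodType R) (F : K -> V) :
      \sum_(k | p k) tht k *: F k = (1 - t) *: (\sum_(k | p k) th k *: F k) + t *: F j.
    under eq_bigr do rewrite scalerDl -!scalerA.
    rewrite big_split /= -!scaler_sumr; congr (_ + _ *: _).
    rewrite (bigD1 j)//= eqxx scale1r big1 ?addr0// => k /andP[_ /negbTE ->].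
    by rewrite scale0r.
  have tht1 : \sum_(k | p k) tht k = 1.
    have := pick R^o (fun=> 1); under eq_bigr do rewrite -[_ *: _]/(_ * _) mulr1.
    move=> ->; under eq_bigr do rewrite -[_ *: _]/(_ * _) mulr1.
    rewrite th1 -!/(_ * _); rewrite -[_ *: _]/(_ * _) -[t *: _]/(_ * _); lra.
  have wtht : weights tht.
    split=> // k pk; rewrite addr_ge0// mulr_ge0 ?ler0n// ?th0// subr_ge0//.
  have mt : m tht - y = (m th - y) + t *: (a j - m th).
    by rewrite /m pick -/(m th); apply/rowP => i; rewrite !mxE; ring.
  have ct : \sum_(k | p k) tht k * c k = (1 - t) * L + t * c j.
    exact: (pick R^o c).
  have := thmin _ wtht; rewrite !critE// mt ct /g /L -/L.
  rewrite /sq; move: (m th - y) (a j - m th) => e h.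
  rewrite dotDl !dotDr !dotZl !dotZr (dotC h e).
  by move=> H; lra.
have -> : \sum_(k | p k) th k * (2 * dot (a k - a j) (y - mu)
      - 2^-1 * sq (a k - a j) - pen k) =
    2 * dot (m th - a j) (y - mu)
    - 2^-1 * (\sum_(k | p k) th k * sq (m th - a k) + sq (m th - a j))
    - \sum_(k | p k) th k * pen k.
  rewrite -barycentre_sq//.
  under eq_bigr do rewrite !mulrBr mulrCA [X in _ - X - _]mulrCA.
  rewrite !sumrB -!mulr_sumr; congr (2 * _ - _ - _).
  under eq_bigr do rewrite dotBl mulrBr.
  rewrite sumrB -mulr_suml th1 mul1r dotBl; congr (_ - _).
  by rewrite dot_suml; apply: eq_bigr => k _; rewrite dotZl.
move: g0; rewrite /g /L /c halfS barycentre_sq//.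
rewrite /sq !(dotBl, dotBr) !(dotC (a j)) !(dotC y) (dotC mu (m th)).
by move=> H; lra.
Qed.

End QAggregation.

(** * Weights of the penalty *)

Section PenaltyWeights.
Variable R : realType.

Lemma expR1_ge2 : 2 <= expR 1 :> R.
Proof. by have := @expR_ge1Dx R 1; rewrite -natr1. Qed.

Lemma sum_expRN_le2 k : \sum_(i < k) expR (- i%:R) <= 2 - 2 * expR (- k%:R) :> R.
Proof.
elim: k => [|k IH]; first by rewrite big_ord0 oppr0 expR0 mulr1 subrr.
rewrite big_ord_recr /= (le_trans (lerD IH (lexx _)))//.
have ek : 2 * expR (- k.+1%:R) <= expR (- k%:R) :> R.
  rewrite -[k.+1%:R]natr1 opprD expRD mulrCA ler_piMr ?expR_ge0//.
  by rewrite expRN ler_pdivrMr ?expR_gt0// mul1r expR1_ge2.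
lra.
Qed.

Lemma HC_le_e n : HC R n <= expR 1.
Proof.
apply: le_trans (sum_expRN_le2 _) (le_trans _ expR1_ge2).
by rewrite lerBlDr lerDl mulr_ge0 ?expR_ge0.
Qed.

Lemma HC_ge1 n : (1 < n)%N -> 1 <= HC R n.
Proof.
case: n => [|[|n]]// _; rewrite /HC /= big_ord_recl oppr0 expR0 lerDl.
by apply: sumr_ge0 => i _; exact: expR_ge0.
Qed.

Lemma card_interior n : (1 < n)%N -> #|interior_idx n| = (n - 2)%N.
Proof.
case: n => [|[|n]]// _; rewrite subSS subSS subn0.
have -> : interior_idx n.+2 = (~: [set ord0; ord_max])%SET.
  apply/setP => i; rewrite !finset.inE -!val_eqE /= negb_or lt0n.
  by rewrite ltnS ltn_neqAle -ltnS ltn_ord andbT.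
by rewrite cardsCs finset.setCK card_ord cards2 -val_eqE /= subSS subSS subn0.
Qed.

Lemma sum_nuJ n : (1 < n)%N ->
  \sum_(J : {set 'I_n} | J \subset interior_idx n) nuJ R J = 1.
Proof.
move=> n1.
have cJ (J : {set 'I_n}) : J \subset interior_idx n -> (#|J| <= n - 2)%N.
  by move=> JI; rewrite -card_interior// subset_leq_card.
have n2 : (n.-1 = (n - 2).+1)%N by rewrite subn2 prednK// -subn1 subn_gt0.
rewrite (partition_big (fun J : {set 'I_n} => inord #|J| : 'I_(n - 2).+1) xpredT)//=.
have -> : 1 = (HC R n)^-1 * \sum_(j < (n - 2).+1) expR (- j%:R).
  by rewrite -n2 mulVf// gt_eqF// (lt_le_trans _ (HC_ge1 n1)).
rewrite mulr_sumr; apply: eq_bigr => j _.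
transitivity (\sum_(J in [set J : {set 'I_n} | (J \subset interior_idx n)
    & #|J| == j]%SET) (expR (- j%:R) / (HC R n * 'C(n - 2, j)%:R))).
  apply: eq_big => [J|J /andP[JI /eqP jJ]]; last first.
    by rewrite /nuJ -jJ inordK// ltnS cJ.
  rewrite finset.inE; apply: andb_id2l => JI.
  by rewrite -val_eqE /= inordK// ltnS cJ.
rewrite sumr_const cards_draws card_interior// -[LHS]mulr_natr.
have Cj : 'C(n - 2, j)%:R != 0 :> R.
  by rewrite pnatr_eq0 -lt0n bin_gt0 -ltnS.
have H0 : HC R n != 0 by rewrite gt_eqF// (lt_le_trans _ (HC_ge1 n1)).
by field; rewrite Cj H0.
Qed.

Lemma nuJ_gt0 n (J : {set 'I_n}) : (1 < n)%N -> J \subset interior_idx n ->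
  0 < nuJ R J.
Proof.
move=> n1 JI; rewrite divr_gt0 ?expR_gt0// mulr_gt0//.
  by rewrite (lt_le_trans _ (HC_ge1 n1)).
by rewrite ltr0n bin_gt0 -card_interior// subset_leq_card.
Qed.

Lemma ln_nuJ n (J : {set 'I_n}) : (1 < n)%N -> J \subset interior_idx n ->
  ln (1 / nuJ R J) = #|J|%:R + ln (HC R n) + ln ('C(n - 2, #|J|)%:R).
Proof.
move=> n1 JI; have H0 : 0 < HC R n by rewrite (lt_le_trans _ (HC_ge1 n1)).
have C0 : 0 < 'C(n - 2, #|J|)%:R :> R.
  by rewrite ltr0n bin_gt0 -card_interior// subset_leq_card.
rewrite div1r lnV ?posrE ?nuJ_gt0// /nuJ lnM ?posrE ?expR_gt0 ?invr_gt0 ?mulr_gt0//.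
rewrite lnV ?posrE ?mulr_gt0// lnM ?posrE// expRK; ring.
Qed.

(** With [x = q / n], one term of the expansion of [(1 + x) ^ m <= exp (m x) <= exp q]
    gives ['C(m, j) <= exp q * (n / q) ^ j]. *)
Lemma binomial_le_expR (m n q j : nat) : (0 < q)%N -> (q <= n)%N -> (m <= n)%N ->
  (j <= q)%N ->
  'C(m, j)%:R <= expR (q%:R * ln (expR 1 * n%:R / q%:R)) :> R.
Proof.
move=> q0 qn mn jq; have n0 : (0 < n)%N by exact: leq_trans qn.
have qR : 0 < q%:R :> R by rewrite ltr0n.
have nR : 0 < n%:R :> R by rewrite ltr0n.
have r1 : 1 <= n%:R / q%:R :> R by rewrite ler_pdivlMr// mul1r ler_nat.
have r0 : 0 < n%:R / q%:R :> R by exact: lt_le_trans r1.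
rewrite mulrC expRM_natr lnK; last by rewrite posrE -mulrA mulr_gt0 ?expR_gt0.
rewrite -mulrA exprMn -expRM_natl mulr1.
have [jm|mj] := leqP j m; last first.
  by rewrite bin_small// mulr_ge0 ?expR_ge0 ?exprn_ge0// ltW.
pose x : R := q%:R / n%:R.
have x0 : 0 < x by rewrite divr_gt0.
have Cx : 'C(m, j)%:R * x ^+ j <= expR q%:R.
  apply: (@le_trans _ _ ((1 + x) ^+ m)).
    rewrite exprDn (bigD1 (Ordinal (n := m.+1) (m := j) jm))//= expr1n mul1r.
    rewrite mulr_natl lerDl; apply: sumr_ge0 => i _.
    by rewrite expr1n mul1r mulrn_wge0// exprn_ge0// ltW.
  apply: (@le_trans _ _ (expR x ^+ m)).
    by rewrite lerXn2r ?nnegrE ?expR_ge0 ?expR_ge1Dx ?addr_ge0 ?(ltW x0).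
  rewrite -expRM_natl ler_expR /x mulrA ler_pdivrMr// mulrC.
  by rewrite ler_pM2l// ler_nat.
have xE : x = (n%:R / q%:R)^-1 by rewrite invf_div.
move: Cx; rewrite xE exprVn ler_pdivrMr ?exprn_gt0// => /le_trans; apply.
by rewrite ler_pM2l ?expR_gt0// ler_weXn2l.
Qed.

Lemma entropy_ge_q (n q : nat) : (0 < q)%N -> (q <= n)%N ->
  q%:R <= q%:R * ln (expR 1 * n%:R / q%:R) :> R.
Proof.
move=> q0 qn; have qR : 0 < q%:R :> R by rewrite ltr0n.
apply: ler_peMr; first exact: ltW.
rewrite -[leLHS](expRK 1) ler_ln ?posrE ?expR_gt0//.
  by rewrite -mulrA; apply: ler_peMr; rewrite ?expR_ge0// ler_pdivlMr// mul1r ler_nat.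
by rewrite -mulrA mulr_gt0 ?expR_gt0// divr_gt0// ltr0n (leq_trans q0).
Qed.

End PenaltyWeights.

(** * Risk of the estimator *)

Lemma integral_affine_le d (T : measurableType d) (R : realType)
    (P : probability T R) (c b e : R) (g : T -> R) :
  0 <= c -> 0 <= b -> (forall x, 0 <= g x) -> measurable_fun setT g ->
  (\int[P]_x (g x)%:E <= e%:E)%E ->
  (\int[P]_x (c + b * g x)%:E <= (c + b * e)%:E)%E.
Proof.
move=> c0 b0 g0 mg ge; under eq_integral do rewrite EFinD.
rewrite ge0_integralD//; last 2 first.
- by move=> x _; rewrite lee_fin mulr_ge0.
- by apply/measurable_EFinP; exact: measurable_funM.
rewrite EFinD leeD//.
  have := integral_cst P measurableT c%:E.
  have PT : (c%:E * P setT = c%:E)%E.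
    by rewrite [X in (_ * X)%E](@probability_setT _ _ _ P) mule1.
  by rewrite PT => cE; rewrite -[leRHS]cE.
by rewrite integralZl_nneg// EFinM lee_wpmul2l// lee_fin.
Qed.

Lemma integral_affine_sum_le d (T : measurableType d) (R : realType)
    (P : probability T R) (I : Type) (s : seq I) (p : pred I) (c b e : R)
    (a m : I -> R) (g : T -> R) (f : I -> T -> R) :
  0 <= c -> 0 <= b -> (forall i, 0 <= a i) ->
  (forall x, 0 <= g x) -> (forall i x, 0 <= f i x) ->
  measurable_fun setT g -> (forall i, measurable_fun setT (f i)) ->
  (\int[P]_x (g x)%:E <= e%:E)%E ->
  (forall i, \int[P]_x (f i x)%:E <= (m i)%:E)%E ->
  (\int[P]_x (c + b * g x + \sum_(i <- s | p i) a i * f i x)%:E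
    <= (c + b * e + \sum_(i <- s | p i) a i * m i)%:E)%E.
Proof.
move=> c0 b0 a0 g0 f0 mg mf ge fm.
elim: s => [|i s IH].
  under eq_integral do rewrite big_nil addr0.
  by rewrite big_nil addr0 integral_affine_le.
rewrite big_cons; under eq_integral do rewrite big_cons.
have [pi|//] := boolP (p i).
under eq_integral do rewrite addrCA EFinD.
rewrite ge0_integralD//; last 4 first.
- by move=> x _; rewrite lee_fin mulr_ge0.
- by apply/measurable_EFinP; exact: measurable_funM.
- move=> x _; rewrite lee_fin addr_ge0//; first by rewrite addr_ge0 ?mulr_ge0.
  by apply: sumr_ge0 => j _; rewrite mulr_ge0.
- apply/measurable_EFinP; apply: measurable_funD.
    by apply: measurable_funD => //; exact: measurable_funM.
  under eq_fun do rewrite big_mkcond.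
  by apply: measurable_sum => j; case: (p j) => //; exact: measurable_funM.
rewrite [X in (_ <= X%:E)%E]addrCA [X in (_ <= X)%E]EFinD; apply: leeD; last exact: IH.
by rewrite integralZl_nneg// EFinM lee_wpmul2l// lee_fin.
Qed.

(** The inequality [1 + z <= exp z] at [z = r / l - t]; the free parameter [t]
    lets the bound stay additive when the mean of [exp (r / l)] is of order [exp t]. *)
Lemma exp_tangent (R : realType) (l t r : R) : 0 < l ->
  r <= l * (t - 1 + expR (- t) * expR (r / l)).
Proof.
move=> l0; rewrite -expRD mulrC -ler_pdivrMr//.
by have := expR_ge1Dx (- t + r / l); lra.
Qed.

Lemma sqrt2_le_e (R : realType) (k : nat) : Num.sqrt 2 ^+ k <= expR k%:R :> R.
Proof.
rewrite -[k%:R]mulr1 expRM_natl lerXn2r ?nnegrE ?sqrtr_ge0 ?expR_ge0//.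
rewrite -ler_sqr ?nnegrE ?sqrtr_ge0 ?expR_ge0// sqr_sqrtr//.
by have := expR1_ge2 R; nra.
Qed.

Lemma snorm_dot (R : realType) (n : nat) (u : 'rV[R]_n) :
  snorm u ^+ 2 = n%:R^-1 * dot u u.
Proof. by rewrite snorm2E; congr (_ * _); apply: eq_bigr => i _; rewrite expr2. Qed.

Section Risk.
Context d (T : measurableType d) (R : realType) (P : probability T R).
Variables (n : nat) (s : R) (xi : 'I_n -> {RV P >-> R}).
Variable muhat : 'rV[R]_n -> 'rV[R]_n.
Hypotheses (n3 : (3 <= n)%N) (s0 : 0 < s) (xiG : gaussian_noise s xi).
Hypothesis muhatP : is_Qconv_estimator s muhat.

Let n1 : (1 < n)%N. Proof. exact: leq_trans n3. Qed.
Let nR : 0 < n%:R :> R. Proof. by rewrite ltr0n (ltnW n1). Qed.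

Definition pen (k : {set 'I_n}) : R :=
  2 * s ^+ 2 * #|k|%:R + 46 * s ^+ 2 * ln (1 / nuJ R k).

Lemma ln_nuJ_ge (k : {set 'I_n}) : k \subset interior_idx n ->
  #|k|%:R <= ln (1 / nuJ R k).
Proof.
move=> kI; rewrite ln_nuJ// -addrA lerDl addr_ge0// ln_ge0 ?HC_ge1//.
by rewrite ler1n bin_gt0 -card_interior// subset_leq_card.
Qed.

Lemma estimator_oracle y mu (J : {set 'I_n}) : J \subset interior_idx n ->
  exists2 th, simplex th &
    dot (muhat y - mu) (muhat y - mu) <=
    dot (y *m QJ R J - mu) (y *m QJ R J - mu) + pen J +
    \sum_(k : {set 'I_n} | k \subset interior_idx n) th k *
      (2 * dot (y *m QJ R k - y *m QJ R J) (y - mu)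
       - 2^-1 * dot (y *m QJ R k - y *m QJ R J) (y *m QJ R k - y *m QJ R J)
       - pen k).
Proof.
move=> JI; have [th [sth thmin] ->] := muhatP y; exists th => //.
apply: (qagg_oracle (p := fun k : {set 'I_n} => k \subset interior_idx n)
  (a := fun k => y *m QJ R k) (pen := pen) (y := y) mu sth JI) => th' sth'.
have QE (t : {set 'I_n} -> R) : Qcrit s y t = n%:R^-1 *
    (dot (mu_theta y t - y) (mu_theta y t - y) +
     \sum_(k : {set 'I_n} | k \subset interior_idx n) t k *
       (2^-1 * dot (mu_theta y t - y *m QJ R k) (mu_theta y t - y *m QJ R k)
        + pen k)).
  rewrite /Qcrit snorm_dot mulrDr [X in _ = _ + X]mulr_sumr; congr (_ + _).
  apply: eq_bigr => k _; rewrite snorm_dot /pen; field.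
  by rewrite gt_eqF.
have := thmin _ sth'; rewrite !QE ler_pM2l ?invr_gt0//.
Qed.

Let X x : 'rV[R]_n := \row_i xi i x.

Let M (b : seq 'rV[R]_n) x :=
  expR ((\sum_(v <- b) dot v (X x) ^+ 2) / (4 * s ^+ 2)).

(** The tangent inequality is used at scale [4 s^2] for the projected noise in
    [a_J] and at scale [8 s^2] for [2 R_(k u J) - pen k], so that both produce
    [exp (R / (4 s^2))].  The [th k] disappear because they sum to 1 and each
    exponential is at most their sum. *)
Lemma pointwise_risk (b : {set 'I_n} -> seq 'rV[R]_n) mu u (J : {set 'I_n}) t x :
  (forall A v z, WJ A v -> 2 * dot v z - dot v v <= \sum_(v <- b A) dot v z ^+ 2) ->
  J \subset interior_idx n -> WJ J u ->
  dot (muhat (obs xi mu x) - mu) (muhat (obs xi mu x) - mu) <=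
  dot (u - mu) (u - mu) + pen J + 12 * s ^+ 2 * (t - 1)
  + 4 * s ^+ 2 * expR (- t) * M (b J) x
  + \sum_(k : {set 'I_n} | k \subset interior_idx n)
      8 * s ^+ 2 * expR (- t) * expR (- (pen k / (8 * s ^+ 2))) * M (b (k :|: J)%SET) x.
Proof.
move=> bP JI uJ; pose Rr A := \sum_(v <- b A) dot v (X x) ^+ 2.
have s2 : 0 < s ^+ 2 by rewrite exprn_gt0.
have [th [th0 th1] le1] := estimator_oracle (obs xi mu x) mu JI.
apply: (le_trans le1).
have -> : obs xi mu x - mu = X x by rewrite /obs addrC addKr.
have le2 := proj_loss mu uJ (fun v vJ => bP J v (X x) vJ).
have le3 : Rr J <= 4 * s ^+ 2 * (t - 1 + expR (- t) * M (b J) x).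
  by apply: exp_tangent; rewrite mulr_gt0.
pose S := \sum_(k : {set 'I_n} | k \subset interior_idx n)
  expR (- (pen k / (8 * s ^+ 2))) * M (b (k :|: J)%SET) x.
have le4 : \sum_(k : {set 'I_n} | k \subset interior_idx n) th k *
      (2 * dot (obs xi mu x *m QJ R k - obs xi mu x *m QJ R J) (X x)
       - 2^-1 * dot (obs xi mu x *m QJ R k - obs xi mu x *m QJ R J)
                    (obs xi mu x *m QJ R k - obs xi mu x *m QJ R J)
       - pen k) <= 8 * s ^+ 2 * (t - 1 + expR (- t) * S).
  rewrite -[leRHS]mul1r -[X in _ <= X * _]th1 mulr_suml; apply: ler_sum => k kI.
  apply: ler_wpM2l; first exact: th0.
  have kJ : WJ (k :|: J)%SET (obs xi mu x *m QJ R k - obs xi mu x *m QJ R J).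
    rewrite addrC -scaleN1r; apply: WJ_lin.
      by apply: (WJ_sub (finset.subsetUr k J)); exact: (QJ_ortho_projector _ _).1.
    by apply: (WJ_sub (finset.subsetUl k J)); exact: (QJ_ortho_projector _ _).1.
  move: (_ *m QJ R k - _) kJ => e eJ.
  (* halving e turns the bound 2 <e, xi> - |e|^2 <= R into
     2 <e, xi> - |e|^2 / 2 <= 2 R *)
  have eJ2 : WJ (k :|: J)%SET (2^-1 *: e).
    by apply/WJ_kermx/scalemx_sub/WJ_kermx.
  have := bP _ _ (X x) eJ2; rewrite !dotZl dotZr -/(Rr _) => le5.
  have le6 : 2 * Rr (k :|: J)%SET - pen k <= 8 * s ^+ 2 *
     (t - 1 + expR (- t) * (expR (- (pen k / (8 * s ^+ 2))) * M (b (k :|: J)%SET) x)).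
    rewrite /M -expRD.
    apply: le_trans (@exp_tangent R (8 * s ^+ 2) t _ _) _.
      by rewrite mulr_gt0.
    rewrite le_eqVlt; apply/orP; left; apply/eqP; congr (_ * (_ + _ * expR _)).
    by rewrite /Rr; field; rewrite gt_eqF.
  apply: (@le_trans _ _ (2 * Rr (k :|: J)%SET - pen k)); first lra.
  apply: (le_trans le6); rewrite ler_pM2l ?mulr_gt0// lerD2l ler_pM2l ?expR_gt0//.
  rewrite /S (bigD1 k)//= lerDl; apply: sumr_ge0 => l _.
  by rewrite mulr_ge0// expR_ge0.
have -> : \sum_(k : {set 'I_n} | k \subset interior_idx n)
      8 * s ^+ 2 * expR (- t) * expR (- (pen k / (8 * s ^+ 2))) * M (b (k :|: J)%SET) x
    = 8 * s ^+ 2 * expR (- t) * S.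
  by rewrite mulr_sumr; apply: eq_bigr => k _; rewrite mulrA.
rewrite -/(X x) in le2.
have -> : obs xi mu x = mu + X x by [].
rewrite -/(Rr J) in le2.
lra.
Qed.

(** [pen k] is at least [8 s^2 (|k| + ln (1 / nuJ k))], as [ln (1 / nuJ k)] is
    at least [|k|].  The factor [exp |k|] absorbs the part of the moment of
    [R_(k u J)] that depends on [k]. *)
Lemma pen_weight (k : {set 'I_n}) : k \subset interior_idx n ->
  expR (- (pen k / (8 * s ^+ 2))) * expR #|k|%:R <= nuJ R k.
Proof.
move=> kI; have nu0 := nuJ_gt0 R n1 kI; have kL := ln_nuJ_ge kI.
rewrite -[leRHS]lnK ?posrE// -expRD ler_expR.
have L : ln (nuJ R k) = - ln (1 / nuJ R k) by rewrite div1r lnV ?opprK.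
have -> : pen k / (8 * s ^+ 2) = #|k|%:R / 4 + 23 / 4 * ln (1 / nuJ R k).
  by rewrite /pen; field; rewrite gt_eqF.
have k0 := ler0n R #|k|; rewrite L; lra.
Qed.

Lemma risk_majorant mu u (J : {set 'I_n}) :
  J \subset interior_idx n -> WJ J u -> exists Z : T -> R,
  [/\ measurable_fun setT Z,
      forall x, snorm (muhat (obs xi mu x) - mu) ^+ 2 <= Z x &
      (\int[P]_x (Z x)%:E <= (snorm (u - mu) ^+ 2
        + n%:R^-1 * (pen J + 12 * s ^+ 2 * (#|J| + 2)%:R))%:E)%E].
Proof.
move=> JI uJ.
have /choice[b bP] : forall A : {set 'I_n}, exists b : seq 'rV[R]_n,
  [/\ orthonormal b, (size b <= #|A| + 2)%N &
      forall v z, WJ A v -> 2 * dot v z - dot v v <= \sum_(v <- b) dot v z ^+ 2].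
  by move=> A; exact: WJ_basis.
pose t : R := (#|J| + 2)%:R.
have mM A : measurable_fun setT (M (b A)).
  apply: measurableT_comp => //; apply: measurable_funM => //.
  exact: measurable_sqr_dot_noise.
have M0 v x : 0 <= M v x by exact: expR_ge0.
have EM A : (\int[P]_x (M (b A) x)%:E <= (expR (#|A| + 2)%:R)%:E)%E.
  have [ob sb _] := bP A.
  have := gaussian_sqr_moment s0 xiG (w := 0) ob.
  have d0 (v : 'rV[R]_n) : dot v 0 = 0 by rewrite -[X in dot v X](scale0r 0) dotZr mul0r.
  under eq_integral do rewrite dotC d0 addr0.
  rewrite d0 mulr0 mul0r expR0 mulr1 => /(_ (fun v _ => d0 v)) h.
  apply: (le_trans h); rewrite lee_fin (le_trans (sqrt2_le_e _ _))// ler_expR.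
  by rewrite ler_nat.
have s2 : 0 < s ^+ 2 by rewrite exprn_gt0.
have L0 : 0 <= ln (1 / nuJ R J) by rewrite (le_trans _ (ln_nuJ_ge JI)).
have t2 : 2 <= t by rewrite /t natrD lerDr.
pose a (k : {set 'I_n}) := n%:R^-1 *
  (8 * s ^+ 2 * expR (- t) * expR (- (pen k / (8 * s ^+ 2)))).
pose c := n%:R^-1 * (dot (u - mu) (u - mu) + pen J + 12 * s ^+ 2 * (t - 1)).
pose b1 := n%:R^-1 * (4 * s ^+ 2 * expR (- t)).
exists (fun x => c + b1 * M (b J) x +
  \sum_(k : {set 'I_n} | k \subset interior_idx n) a k * M (b (k :|: J)%SET) x).
have b10 : 0 <= b1.
  by rewrite !mulr_ge0 ?invr_ge0 ?expR_ge0// ltW.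
have a0 k : 0 <= a k.
  by rewrite !mulr_ge0 ?invr_ge0 ?expR_ge0// ltW.
have c0 : 0 <= c.
  have pen0 : 0 <= pen J by rewrite /pen addr_ge0// !mulr_ge0// ltW.
  have t10 : 0 <= 12 * s ^+ 2 * (t - 1).
    by apply: mulr_ge0; [rewrite mulr_ge0// ltW|lra].
  by have uu0 := dot_ge0 (u - mu); apply: mulr_ge0; [rewrite invr_ge0|lra].
split.
- apply: measurable_funD; first by apply: measurable_funD => //; exact: measurable_funM.
  under eq_fun do rewrite big_mkcond.
  by apply: measurable_sum => k; case: (_ \subset _) => //; exact: measurable_funM.
- move=> x; rewrite snorm_dot.
  have := pointwise_risk mu t x (fun A => let: And3 _ _ h := bP A in h) JI uJ.
  rewrite -(ler_pM2l (_ : 0 < n%:R^-1)) ?invr_gt0// => /le_trans; apply.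
  rewrite le_eqVlt; apply/orP; left; apply/eqP.
  rewrite mulrDr mulrDr mulr_sumr /c /b1 /M -[n%:R^-1 * _ * _]mulrA.
  by congr (_ + _); apply: eq_bigr => k _; rewrite /a -[RHS]mulrA.
have := integral_affine_sum_le (P := P) (index_enum _)
  (fun k : {set 'I_n} => k \subset interior_idx n)
  c0 b10 a0 (M0 (b J)) (fun k => M0 (b (k :|: J)%SET)) (mM J)
  (fun k => mM (k :|: J)%SET) (EM J) (fun k => EM (k :|: J)%SET).
move=> /le_trans; apply; rewrite lee_fin.
have eJ : expR (- t) * expR (#|J| + 2)%:R = 1 by rewrite -expRD addNr expR0.
have -> : b1 * expR (#|J| + 2)%:R = n%:R^-1 * (4 * s ^+ 2).
  by rewrite /b1 -!mulrA eJ mulr1.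
have sa : \sum_(k : {set 'I_n} | k \subset interior_idx n)
    a k * expR (#|(k :|: J)%SET| + 2)%:R <= n%:R^-1 * (8 * s ^+ 2).
  rewrite -[leRHS]mulr1 -[X in _ <= _ * X](sum_nuJ R n1) mulr_sumr; apply: ler_sum => k kI.
  have -> : a k * expR (#|(k :|: J)%SET| + 2)%:R = n%:R^-1 * (8 * s ^+ 2) *
      (expR (- t) * (expR (- (pen k / (8 * s ^+ 2))) * expR (#|(k :|: J)%SET| + 2)%:R)).
    by rewrite /a; ring.
  rewrite ler_pM2l ?mulr_gt0 ?invr_gt0//.
  apply: le_trans (pen_weight kI).
  rewrite mulrCA ler_pM2l ?expR_gt0// -expRD ler_expR addrC lerBlDr /t -natrD.
  by rewrite ler_nat addnA leq_add2r cardsU leq_subr.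
rewrite snorm_dot; apply: (le_trans (lerD (lexx _) sa)).
rewrite le_eqVlt; apply/orP; left; apply/eqP; rewrite /c; ring.
Qed.

Lemma pen_le (q : nat) (J : {set 'I_n}) : (q <= n)%N ->
  J \subset interior_idx n -> (#|J| < q)%N ->
  pen J + 12 * s ^+ 2 * (#|J| + 2)%:R <=
  118 * s ^+ 2 * (q%:R * ln (expR 1 * n%:R / q%:R)).
Proof.
move=> qn JI Jq; have q0 : (0 < q)%N by exact: leq_ltn_trans Jq.
set Lq := q%:R * _.
have qL : q%:R <= Lq by exact: entropy_ge_q.
have C0 : 0 < 'C(n - 2, #|J|)%:R :> R.
  by rewrite ltr0n bin_gt0 -card_interior// subset_leq_card.
have CL : ln ('C(n - 2, #|J|)%:R) <= Lq.
  rewrite -[leRHS]expRK ler_ln ?posrE ?expR_gt0//.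
  by apply: binomial_le_expR => //; [exact: leq_subr|exact: ltnW].
have H1 : ln (HC R n) <= 1.
  rewrite -[leRHS]expRK ler_ln ?posrE ?expR_gt0// ?HC_le_e//.
  by rewrite (lt_le_trans _ (HC_ge1 R n1)).
have Jq' : #|J|%:R + 1 <= q%:R :> R by rewrite natr1 ler_nat.
have J0 := ler0n R #|J|.
rewrite /pen ln_nuJ// natrD.
have s2 : 0 < s ^+ 2 by rewrite exprn_gt0.
rewrite -subr_ge0 [X in 0 <= X](_ : _ = s ^+ 2 * (118 * Lq - 2 * #|J|%:R
  - 46 * (#|J|%:R + ln (HC R n) + ln ('C(n - 2, #|J|)%:R)) - 12 * (#|J|%:R + 2))); last by ring.
rewrite mulr_ge0 ?ltW//; lra.
Qed.

End Risk.

(** * Oracle inequalities *)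

(** The tangent to the square root at [m ^+ 2 + B]: integrating it plays the role
    of Jensen's inequality without measurability of [x]. *)
Lemma sqrt_majorant (R : realType) (m B x z : R) : 0 <= m -> 0 < B ->
  0 <= x -> x ^+ 2 <= z ->
  x <= Num.sqrt (m ^+ 2 + B) / 2 + (2 * Num.sqrt (m ^+ 2 + B))^-1 * z.
Proof.
move=> m0 B0 x0 xz; set r := Num.sqrt _.
have r0 : 0 < r by rewrite sqrtr_gt0 ltr_wpDl ?sqr_ge0.
apply: le_trans (_ : r / 2 + (2 * r)^-1 * x ^+ 2 <= _); last first.
  by rewrite lerD2l ler_pM2l// invr_gt0 mulr_gt0.
rewrite -subr_ge0 [X in 0 <= X](_ : _ = (2 * r)^-1 * (r - x) ^+ 2); last first.
  by field; rewrite gt_eqF.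
by rewrite mulr_ge0 ?sqr_ge0// invr_ge0 mulr_ge0// ltW.
Qed.

Lemma sqrtD_le (R : realType) (m B : R) : 0 <= m -> 0 <= B ->
  Num.sqrt (m ^+ 2 + B) <= m + Num.sqrt B.
Proof.
move=> m0 B0; rewrite -ler_sqr ?nnegrE ?addr_ge0 ?sqrtr_ge0//.
rewrite sqr_sqrtr ?addr_ge0 ?sqr_ge0// sqrrD sqr_sqrtr//.
by rewrite lerD2r lerDl mulrn_wge0// mulr_ge0 ?sqrtr_ge0.
Qed.

Lemma kinks_WJ (R : realType) (n q : nat) (u : 'rV[R]_n) : SCq q u ->
  exists J : {set 'I_n}, [/\ J \subset interior_idx n, (#|J| < q)%N & WJ J u].
Proof.
move=> [_ uq]; exists [set i in interior_idx n | 2 * u 0 i != nbr_sum u i]%SET.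
split=> // [|i].
  by apply/fintype.subsetP => i; rewrite finset.inE => /andP[].
by rewrite !finset.inE => /andP[+ iI]; rewrite iI /= negbK => /eqP.
Qed.

Theorem mainTheorem5 (R : realType) :
  exists2 c : R, 0 < c &
  forall (n : nat) (sigma : R) (q : nat)
    (d : measure_display) (T : measurableType d) (P : probability T R)
    (xi : 'I_n -> {RV P >-> R}) (muhat : 'rV[R]_n -> 'rV[R]_n),
  (3 <= n)%N -> 0 < sigma -> (1 <= q <= n)%N ->
  gaussian_noise sigma xi ->
  is_Qconv_estimator sigma muhat ->
  (ereal_sup [set ('E_P[(fun w => snorm (muhat (obs xi mu w) - mu))%R]
                   - (inf [set snorm (u - mu) | u in @SCq R n q])%R%:E)%E
             | mu in [set: 'rV[R]_n]]
   <= (c * Num.sqrt (sigma ^+ 2 * q%:R / n%:R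
                     * ln (expR 1 * n%:R / q%:R)))%:E)%E
  /\
  (ereal_sup [set ('E_P[(fun w => snorm (muhat (obs xi mu w) - mu) ^+ 2)%R]
                   - (inf [set snorm (u - mu) ^+ 2 | u in @SCq R n q])%R%:E)%E
             | mu in [set: 'rV[R]_n]]
   <= (c * sigma ^+ 2 * q%:R / n%:R * ln (expR 1 * n%:R / q%:R))%:E)%E.
Proof.
exists 118 => // n sigma q d T P xi muhat n3 s0 /andP[q0 qn] xiG muhatP.
set l := ln (expR 1 * n%:R / q%:R).
have nR : 0 < n%:R :> R by rewrite ltr0n (leq_trans q0).
have qR : 0 < q%:R :> R by rewrite ltr0n.
have l0 : 0 < l.
  rewrite -(pmulr_rgt0 _ qR); apply: lt_le_trans (entropy_ge_q R q0 qn).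
  exact: qR.
pose B := 118 * (sigma ^+ 2 * q%:R / n%:R * l).
have B0 : 0 < B by rewrite !mulr_gt0 ?invr_gt0// exprn_gt0.
have risk mu : exists u0 : 'rV[R]_n, exists Z : T -> R, [/\ SCq q u0,
    forall u, SCq q u -> snorm (u0 - mu) <= snorm (u - mu),
    measurable_fun setT Z,
    forall x, snorm (muhat (obs xi mu x) - mu) ^+ 2 <= Z x &
    (\int[P]_x (Z x)%:E <= (snorm (u0 - mu) ^+ 2 + B)%:E)%E].
  have [u0 u0q u0min] := SCq_dist_attained mu q0.
  have [J [JI Jq u0J]] := kinks_WJ u0q.
  have [Z [mZ Zle EZ]] := risk_majorant n3 s0 xiG muhatP mu JI u0J.
  exists u0, Z; split=> //; apply: (le_trans EZ); rewrite lee_fin lerD2l.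
  have := pen_le n3 s0 qn JI Jq; rewrite -/l => pl.
  rewrite mulrC ler_pdivrMr//; apply: (le_trans pl).
  rewrite le_eqVlt; apply/orP; left; apply/eqP; rewrite /B.
  by field; rewrite gt_eqF.
split; apply: ge_ereal_sup => _ [mu _ <-]; rewrite leeBlDr//.
all: have [u0 [Z [u0q u0min mZ Zle EZ]]] := risk mu; rewrite unlock.
- pose r := Num.sqrt (snorm (u0 - mu) ^+ 2 + B).
  have r0 : 0 < r by rewrite sqrtr_gt0 ltr_wpDl ?sqr_ge0.
  have Z0 x : 0 <= Z x by exact: le_trans (sqr_ge0 _) (Zle x).
  apply: (@le_trans _ _ (\int[P]_x (r / 2 + (2 * r)^-1 * Z x)%:E)%E).
    apply: ge0_le_integral_lower => x; rewrite lee_fin; first exact: sqrtr_ge0.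
    by apply: sqrt_majorant; rewrite ?sqrtr_ge0.
  have r2 : 0 <= r / 2 by rewrite divr_ge0// ltW.
  have r1 : 0 <= (2 * r)^-1 by rewrite invr_ge0 mulr_ge0// ltW.
  apply: (le_trans (integral_affine_le r2 r1 Z0 mZ EZ)).
  have rr : r ^+ 2 = snorm (u0 - mu) ^+ 2 + B.
    by rewrite sqr_sqrtr// addr_ge0 ?sqr_ge0// ltW.
  have -> : r / 2 + (2 * r)^-1 * (snorm (u0 - mu) ^+ 2 + B) = r.
    by rewrite -rr; field; rewrite gt_eqF.
  rewrite -EFinD lee_fin addrC.
  apply: (le_trans (sqrtD_le (sqrtr_ge0 _) (ltW B0))); apply: lerD.
    apply: lb_le_inf; first by exists (snorm (u0 - mu)); exists u0.
    by move=> _ [u uq <-]; exact: u0min.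
  rewrite /B sqrtrM// ler_wpM2r ?sqrtr_ge0//.
  rewrite -ler_sqr ?nnegrE ?sqrtr_ge0// sqr_sqrtr//; lra.
apply: (@le_trans _ _ (\int[P]_x (Z x)%:E)%E).
  apply: ge0_le_integral_lower => x; rewrite lee_fin; first exact: sqr_ge0.
  exact: Zle.
apply: (le_trans EZ); rewrite -EFinD lee_fin addrC; apply: lerD.
  by rewrite /B !mulrA.
apply: lb_le_inf; first by exists (snorm (u0 - mu) ^+ 2); exists u0.
by move=> _ [u uq <-]; rewrite ler_sqr ?nnegrE ?sqrtr_ge0//; exact: u0min.
Qed.
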